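(* Let $p$ be a prime, $t\geq2$, and $m=t-1$. For every $r\geq1$, the dimension $d_t(p^r)=\dim\mathfrak{D}_t(\mathbb{Z}/p^r\mathbb{Z})$ is given by $$d_t(p^r)=1+\sum_{a=1}^rN_m(a)+\sum_{1\leq b\leq a\leq r}\varphi(p^b)N_m(a,b),$$ where $\varphi$ is Euler's totient function and the last sum is omitted when $m=1$.
   Context: **Commutant.** For $N\geq1$ let $A=\mathbb{Z}/N\mathbb{Z}$, $\widehat{A}=\mathrm{Hom}(A,U(1))$, $\mathcal{H}=\mathbb{C}[A]$ with orthonormal basis $|b\rangle$, $b\in A$; for $(a,\chi)\in A\oplus\widehat{A}$ let $W_{(a,\chi)}|b\rangle=\chi(b)|a+b\rangle$. Let $H(A)=\{zW_v:z\in U(1),v\in A\oplus\widehat{A}\}$ and $C(A)=N_{U(\mathcal{H})}(H(A))/(U(1)\cdot I)$ the projective Clifford group; for $g\in C(A)$ let $U_g$ be any unitary representative of $g$. Then $$\mathfrak{D}_t(A)=\{X\in\mathrm{End}_{\mathbb{C}}(\mathcal{H}^{\otimes t}):XU_g^{\otimes t}=U_g^{\otimes t}X\text{ for every }g\in C(A)\}$$ (independent of the choice of representatives), and $d_t(N)=\dim\mathfrak{D}_t(\mathbb{Z}/N\mathbb{Z})$. **Counting functions.** For integers $0\leq j\leq m$ let $\binom{m}{j}_p=\prod_{i=0}^{j-1}\frac{p^{m-i}-1}{p^{j-i}-1}$ be the Gaussian binomial coefficient. For $a\geq1$, $$N_m(a)=p^{(a-1)(m-1)}\binom{m}{1}_p.$$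 For $m\geq2$ and $a\geq b\geq1$, $$N_m(a,b)=\begin{cases}p^{2(a-1)(m-2)}\binom{m}{2}_p,&a=b,\\[1mm]p^{(2b-1)(m-2)+(a-b-1)(m-1)}\binom{m-1}{1}_p\binom{m}{1}_p,&a>b.\end{cases}$$ *)

(* Defs.v *)
From HB Require Import structures.
From mathcomp Require Import all_boot all_order all_algebra.
From mathcomp Require Import spectral.
From mathcomp Require Import boolp classical_sets reals.
From mathcomp Require Import complex.

Set Implicit Arguments.
Unset Strict Implicit.
Unset Printing Implicit Defensive.

Import Order.TTheory GRing.Theory Num.Theory.
Local Open Scope classical_set_scope.
Local Open Scope ring_scope.

Section LinearPredicate.
Variables (K : fieldType) (vT : vectType K) (P : set vT).
Hypotheses (P0 : P 0) (PD : forall a u v, P u -> P v -> P (a *: u + v)).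

Lemma linear_set_vspace : exists V : {vspace vT}, forall v, v \in V <-> P v.
Proof.
pose Q k := `[< exists V : {vspace vT}, \dim V = k /\ {in V, forall v, P v} >].
have exQ : exists k, Q k.
  exists 0%N; apply/asboolP; exists 0%VS; split; first exact: dimv0.
  by move=> v; rewrite memv0 => /eqP ->.
have ubQ k : Q k -> (k <= \dim {:vT})%N.
  by move=> /asboolP[V [<- _]]; apply/dimvS/subvf.
have [k /asboolP[V [dimV VP]] maxk] := ex_maxnP exQ ubQ.
exists V => v; split=> [|Pv]; first exact: VP.
have: Q (\dim (<[v]> + V)).
  apply/asboolP; exists (<[v]> + V)%VS; split=> // w.
  by move=> /memv_addP[_ /vlineP[a ->] [u Vu ->]]; apply: PD => //; apply: VP.
move=> /maxk; rewrite -dimV => le_dim.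
have /eqP -> : (V == <[v]> + V)%VS by rewrite eqEdim addvSr.
by apply: (subvP (addvSl _ _)); apply: memv_line.
Qed.

End LinearPredicate.

Section Clifford.
Variable R : realType.
Local Notation C := R[i].

Definition U1 : set C := [set z | `|z| = 1].

(* Throughout this section N = n.+1 and Z/NZ is 'I_n.+1 with its additive
   group structure (addition modulo n.+1); it is the trivial group for n = 0. *)

Definition is_character n (chi : 'I_n.+1 -> C) : Prop :=
  (forall a, U1 (chi a)) /\ (forall a b, chi (a + b) = chi a * chi b).

(* Operators act on column vectors: column b is the image of |b>, so this is
   |b> |-> chi(b) |a + b>. *)
Definition weyl n (a : 'I_n.+1) (chi : 'I_n.+1 -> C) : 'M[C]_n.+1 :=
  \matrix_(i, b) (chi b *+ (i == a + b)).

Definition heisenberg n : set 'M[C]_n.+1 :=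
  [set M | exists z a chi,
     [/\ U1 z, is_character chi & M = z *: weyl a chi]].

Definition clifford_normalizer n : set 'M[C]_n.+1 :=
  [set U | U \is unitarymx /\
     (fun M => U *m M *m invmx U) @` @heisenberg n = @heisenberg n].

(* An element of the quotient by U(1) * I is the coset of all its unitary
   representatives. *)
Definition clifford n : set (set 'M[C]_n.+1) :=
  [set (fun z => z *: U) @` U1 | U in @clifford_normalizer n].

(* The basis vectors |b_0> (x) ... (x) |b_(t-1)> of the t-th tensor power are
   indexed by the functions b : 'I_t -> Z/NZ, numbered through enum_val. *)
Definition tensor_dim n t : nat := #|{ffun 'I_t -> 'I_n.+1}|.

Definition tensor_power n t (U : 'M[C]_n.+1) : 'M[C]_(tensor_dim n t) :=
  \matrix_(x, y) \prod_(k < t)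
    U ((enum_val x : {ffun 'I_t -> 'I_n.+1}) k)
      ((enum_val y : {ffun 'I_t -> 'I_n.+1}) k).

Definition commutes_clifford n t : set 'M[C]_(tensor_dim n t) :=
  [set X | forall g, @clifford n g -> forall U, g U ->
     X *m tensor_power t U = tensor_power t U *m X].

Lemma commutes_clifford_vspace n t :
  exists V : {vspace 'M[C]_(tensor_dim n t)},
    forall X, X \in V <-> @commutes_clifford n t X.
Proof.
apply: linear_set_vspace => [g _ U _|a X Y XP YP g gC U gU].
  by rewrite mul0mx mulmx0.
rewrite mulmxDl mulmxDr -scalemxAl -scalemxAr.
by rewrite (XP g gC U gU) (YP g gC U gU).
Qed.

Definition commutant n t : {vspace 'M[C]_(tensor_dim n t)} :=
  sval (cid (commutes_clifford_vspace n t)).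

Lemma mem_commutant n t X :
  X \in commutant n t <-> @commutes_clifford n t X.
Proof. exact: (svalP (cid (commutes_clifford_vspace n t))). Qed.

(* Meaningful for 0 < N only. *)
Definition commutant_dim t N : nat := \dim (commutant N.-1 t).

End Clifford.

Definition gauss_binom (p m j : nat) : rat :=
  \prod_(0 <= i < j) ((p%:R ^+ (m - i) - 1) / (p%:R ^+ (j - i) - 1)).

(* The subtractions in the exponents are those of nat; they are exact for
   1 <= m, 1 <= a in Ncyc, and for 2 <= m, 1 <= b <= a in Npair. *)
Definition Ncyc (p m a : nat) : rat :=
  p%:R ^+ ((a - 1) * (m - 1)) * gauss_binom p m 1.

Definition Npair (p m a b : nat) : rat :=
  if a == b then p%:R ^+ (2 * (a - 1) * (m - 2)) * gauss_binom p m 2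
  else p%:R ^+ ((2 * b - 1) * (m - 2) + (a - b - 1) * (m - 1))
       * gauss_binom p (m - 1) 1 * gauss_binom p m 1.

(* Main.v *)
Require Import Defs.
From mathcomp Require Import boolp classical_sets.
From mathcomp Require Import all_boot all_order all_algebra all_fingroup.
From mathcomp Require Import cyclic separable cyclotomic spectral.
From mathcomp Require Import ring zify reals complex.

Set Implicit Arguments.
Unset Strict Implicit.
Unset Printing Implicit Defensive.

Import Order.TTheory GRing.Theory Num.Theory.
Local Open Scope ring_scope.

(** The Weyl operators W_v, indexed by the plane V = (Z/N)^2, form a basis of
    the operators on C[Z/N], and a Clifford unitary U permutes them up to
    phases: U W_v U^-1 is a multiple of W_(g v) for a matrix g, which has
    determinant 1 because conjugation preserves commutators
    ([normalizer_implements]).  Conversely every g in SL_2(Z/N) arises in this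
    way: the Fourier transform and a quadratic phase realise the two standard
    matrices, and these generate SL_2 as soon as Z/N is local
    ([implementable_det1]).

    On the t-fold tensor power the products W_(v_1) (x) ... (x) W_(v_t) are a
    basis.  Commuting with the diagonal Weyl operators kills every basis vector
    with v_1 + ... + v_t <> 0.  On those with zero sum the ordered product
    W_(v_1) ... W_(v_t) is a nonzero scalar; dividing by it cancels the phases
    that a Clifford unitary produces ([tensor_power_weyl_normalized]), for N
    even as well as odd.  Hence the commutant consists of the combinations whose
    coefficients are constant on SL_2(Z/N)-orbits, and as a zero-sum t-tuple is
    determined by m = t - 1 of its members, the dimension is the number of orbits
    of SL_2(Z/N) on the 2 x m matrices ([commutant_dim_orbits]).

    For N = p^r let p^A, A = a + 1, be the exact annihilator of a nonzero matrix
    and j the first column not killed by p^a.  SL_2 moves that column to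
    (p^(r-A), 0), and what is left of the orbit is the set of matrices with rows
    x + s z and z, s in Z/N, where x and z are the two rows.  The number of
    orbits is therefore the sum of 1 / |(Z/N) z| over all normal forms
    ([card_sl2_classes]).  Here |(Z/N) z| = p^b with p^b the order of z, and the
    vectors z killed by p^b are easily counted.  For each a, the terms b = 0 add
    up to N_m(A), and the terms of order p^b, with b from 1 to A, to
    phi(p^b) N_m(A, b). *)

(** * Linear independence and invariant combinations *)
Lemma partition_set0 (T : finType) (P : {set {set T}}) (D : {set T}) :
  partition P D -> set0 \notin P.
Proof. by case/and3P. Qed.

Section IndexedFamily.
Variables (K : fieldType) (vT : vectType K).

Definition independent (I : finType) (F : I -> vT) : Prop :=
  forall x : I -> K, \sum_i x i *: F i = 0 -> forall i, x i = 0.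

Definition family_tuple (I : finType) (F : I -> vT) : #|I|.-tuple vT :=
  [tuple F (enum_val k) | k < #|I|].

Lemma sum_family_tuple (I : finType) (F : I -> vT) (x : I -> K) :
  \sum_i x i *: F i = \sum_(k < #|I|) x (enum_val k) *: (family_tuple F)`_k.
Proof.
rewrite (reindex _ (onW_bij _ (enum_val_bij I))) /=.
by apply: eq_bigr => k _; rewrite (nth_mktuple (fun k => F (enum_val k))).
Qed.

Lemma free_family_tuple (I : finType) (F : I -> vT) :
  independent F -> free (family_tuple F).
Proof.
move=> freeF; apply/freeP => k k0 i.
have kE j : k j = (k \o enum_rank) (enum_val j) by rewrite /= enum_valK.
rewrite kE; apply: freeF; rewrite sum_family_tuple.
by under eq_bigr do rewrite -kE.
Qed.

Lemma mem_span_family_tuple (I : finType) (F : I -> vT) u :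
  u \in <<family_tuple F>>%VS <-> exists x : I -> K, u = \sum_i x i *: F i.
Proof.
split=> [uF|[x ->]]; last first.
  rewrite sum_family_tuple; apply: memv_suml => k _; apply/memvZ/memv_span.
  by rewrite mem_nth // size_tuple.
exists (fun i => coord (family_tuple F) (enum_rank i) u).
rewrite sum_family_tuple {1}(coord_span uF).
by apply: eq_bigr => k _; rewrite enum_valK.
Qed.

Lemma independent_dim (I : finType) (F : I -> vT) (V : {vspace vT}) :
  independent F ->
  (forall u, u \in V <-> exists x : I -> K, u = \sum_i x i *: F i) ->
  \dim V = #|I|.
Proof.
move=> freeF spanF; have -> : V = <<family_tuple F>>%VS.
  apply/vspaceP => u; apply/idP/idP.
    by move=> /spanF/mem_span_family_tuple.
  by move=> /mem_span_family_tuple/spanF.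
by have := free_family_tuple freeF; rewrite /free size_tuple => /eqP.
Qed.

Lemma independent_span (I : finType) (F : I -> vT) (u : vT) :
  independent F -> #|I| = \dim {:vT} ->
  exists x : I -> K, u = \sum_i x i *: F i.
Proof.
move=> /free_family_tuple freeF cardI; apply/mem_span_family_tuple.
suff -> : <<family_tuple F>>%VS = fullv by rewrite memvf.
apply/eqP; rewrite eqEdim subvf /= -cardI.
by move: freeF; rewrite /free size_tuple => /eqP ->.
Qed.

Lemma independent_comp (I J : finType) (F : J -> vT) (h : I -> J) (c : I -> K) :
  injective h -> (forall i, c i != 0) -> independent F ->
  independent (fun i => c i *: F (h i)).
Proof.
move=> h_inj c_neq0 freeF x x0 i.
have /freeF/(_ (h i)) : \sum_j (\sum_(i | h i == j) x i * c i) *: F j = 0.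
  rewrite -[RHS]x0; under eq_bigr do rewrite scaler_suml.
  rewrite (exchange_big_dep xpredT) //=; apply: eq_bigr => k _.
  by rewrite (big_pred1 (h k)) ?scalerA.
rewrite (big_pred1 i) => [|k]; last by rewrite (inj_eq h_inj).
by move=> /eqP; rewrite mulf_eq0 (negPf (c_neq0 i)) orbF => /eqP.
Qed.

(** The sums of [F] over the classes of [e] are a basis of [V]. *)
Lemma invariant_combination_dim (I : finType) (e : rel I) (F : I -> vT)
    (V : {vspace vT}) :
  equivalence_rel e -> independent F ->
  (forall u, u \in V <-> exists2 x : I -> K,
     (forall i j, e i j -> x i = x j) & u = \sum_i x i *: F i) ->
  \dim V = #|equivalence_partition e [set: I]|.
Proof.
move=> eqe freeF spanF; set P := equivalence_partition e setT.
have eqT : {in [set: I] & &, equivalence_rel e} by move=> x y z _ _ _; apply: eqe.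
have partP : partition P setT by apply: equivalence_partitionP.
have trivP := partition_trivIset partP.
have covP i : i \in cover P by rewrite (cover_partition partP) inE.
have sameP i j : (j \in pblock P i) = e i j.
  by rewrite pblock_equivalence_partition ?inE.
pose cls i : {B : {set I} | B \in P} := Sub (pblock P i) (pblock_mem (covP i)).
have clsE i (B : {B | B \in P}) : (i \in val B) = (cls i == B).
  apply/idP/eqP => [iB|<-]; last by rewrite mem_pblock.
  by apply: val_inj; apply: def_pblock (valP B) iB.
have sumG (y : {B | B \in P} -> K) :
    \sum_B y B *: \sum_(i in val B) F i = \sum_i y (cls i) *: F i.
  under eq_bigr do rewrite scaler_sumr.
  rewrite (exchange_big_dep xpredT) //=; apply: eq_bigr => i _.
  by rewrite (big_pred1 (cls i)) // => B; rewrite clsE eq_sym.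
have repB (B : {B | B \in P}) : exists i, cls i = B.
  case: B => B BP; have/set0Pn[i iB] : B != set0.
    by apply: contraNneq (partition_set0 partP) => <-.
  by exists i; apply/eqP; rewrite -clsE.
rewrite -[RHS]card_sig.
apply: (independent_dim (F := fun B : {B | B \in P} => \sum_(i in val B) F i)).
  move=> y.
  by rewrite sumG => /freeF y0 B; have [i <-] := repB B; apply: y0.
move=> u; split=> [/spanF[x xe ->]|[y ->]].
  have /fin_all_exists[rep repE] := repB.
  exists (fun B => x (rep B)); rewrite sumG; apply: eq_bigr => i _.
  by congr (_ *: _); apply: xe; rewrite -sameP -[pblock P i]/(val (cls i)) clsE repE.
apply/spanF; exists (y \o cls); last by rewrite sumG.
move=> i j eij /=; congr y; apply/eqP; rewrite eq_sym -clsE /=.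
by rewrite sameP.
Qed.

End IndexedFamily.

(** * Roots of unity and counting of classes *)

(** In characteristic 0 the polynomial X^n - 1 is separable, so in an
    algebraically closed field it has n distinct roots, and a finite group of
    roots of unity is cyclic. *)
Lemma primitive_root_exists (C : numClosedFieldType) n :
  (0 < n)%N -> exists z : C, n.-primitive_root z.
Proof.
move=> n_gt0; have [rs] := closed_field_poly_normal ('X^n - 1 : {poly C}).
rewrite lead_coefDl ?lead_coefXn ?scale1r; last first.
  by rewrite size_polyXn size_polyN size_poly1.
move=> rsE.
have rs_roots : all n.-unity_root rs.
  by apply/allP => z; rewrite -root_prod_XsubC -rsE.
have rs_size : (n <= size rs)%N.
  by have := size_prod_XsubC rs id; rewrite -rsE size_XnsubC // => -[->].
have rs_uniq : uniq rs.
  by rewrite -separable_prod_XsubC -rsE separable_Xn_sub_1 // pnatr_eq0 -lt0n.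
by have /hasP[z _ zP] := has_prim_root n_gt0 rs_roots rs_uniq rs_size; exists z.
Qed.

(** A class containing k normal forms receives k times the weight 1 / k. *)
Lemma card_classes_normal_form (T : finType) (e : rel T) (NF : {set T})
    (size_in : T -> nat) :
  equivalence_rel e ->
  (forall x, exists2 y, y \in NF & e x y) ->
  (forall y, y \in NF -> #|[set z in NF | e y z]| = size_in y) ->
  #|equivalence_partition e [set: T]|%:R
    = \sum_(y in NF) (size_in y)%:R^-1 :> rat.
Proof.
move=> eqe meet cnt; set P := equivalence_partition e setT.
have eqT : {in [set: T] & &, equivalence_rel e} by move=> x y z _ _ _; apply: eqe.
have partP : partition P setT by apply: equivalence_partitionP.
have trivP := partition_trivIset partP.
rewrite [RHS](partition_big (pblock P) (mem P)) => [|y _]; last first.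
  by apply: pblock_mem; rewrite (cover_partition partP) inE.
rewrite -sumr_const; apply: eq_bigr => B BP /=.
have/set0Pn[x xB] : B != set0.
  by apply: contraNneq (partition_set0 partP) => <-.
have BE y : (y \in B) = e x y.
  by rewrite -(def_pblock trivP BP xB) pblock_equivalence_partition ?inE.
have inB y : (pblock P y == B) = e x y.
  rewrite -BE; apply/eqP/idP => [<-|]; last exact: def_pblock.
  by rewrite mem_pblock (cover_partition partP) inE.
have eE y z : e x y -> e y z = e x z by move=> xy; case: (eqe x y z) => _ ->.
have [y0 y0N xy0] := meet x.
rewrite (eq_bigl (mem [set y in NF | e x y])); last first.
  by move=> y; rewrite /= !inE inB.
have sizeE y : y \in [set y in NF | e x y] ->
    size_in y = #|[set z in NF | e x z]|.
  rewrite inE => /andP[yN xy]; rewrite -cnt //.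
  by apply: eq_card => z; rewrite !inE eE.
rewrite (eq_bigr (fun=> (#|[set z in NF | e x z]|%:R)^-1)) => [|y yP]; last first.
  by rewrite (sizeE y yP).
rewrite sumr_const -[RHS]mulr_natl divff // pnatr_eq0 -lt0n.
by apply/card_gt0P; exists y0; rewrite inE y0N.
Qed.

(** * Weyl operators and the unitaries that normalise them *)
Lemma ord2E (i : 'I_2) : i = 0 \/ i = 1.
Proof. by case: i => [[|[|//]] ?]; [left|right]; apply/val_inj. Qed.

Lemma cV2_eq (T : Type) (v w : 'cV[T]_2) :
  v 0 0 = w 0 0 -> v 1 0 = w 1 0 -> v = w.
Proof. by move=> v0 v1; apply/matrixP=> i j; rewrite ord1; case: (ord2E i) => ->. Qed.

Lemma sum2E (V : nmodType) (F : 'I_2 -> V) : \sum_i F i = F 0 + F 1.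
Proof.
by rewrite big_ord_recl big_ord1; congr (_ + F _); apply/val_inj.
Qed.

Section Weyl.
Variables (R : realType) (n : nat).
Local Notation C := R[i].
Local Notation N := n.+2.
Variable zeta : C.
Hypothesis zetaP : (2 * N).-primitive_root zeta.

(** [zeta ^+ 2] is a primitive N-th root of unity; the quadratic phase defined
    further on needs its square root [zeta], since for even N the form b^2 / 2 is
    not defined modulo N. *)
Definition phase (k : 'I_N) : C := zeta ^+ (2 * k).

Lemma phase_nat m (k : 'I_N) : m = k %[mod N] -> zeta ^+ (2 * m) = phase k.
Proof.
move=> mk; apply/eqP; rewrite (eq_prim_root_expr zetaP).
by rewrite -!muln_modr mk.
Qed.

Lemma phaseD a b : phase (a + b) = phase a * phase b.
Proof. by rewrite -exprD -mulnDr; apply/esym/phase_nat; rewrite /= modn_mod. Qed.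

Lemma phase0 : phase 0 = 1.
Proof. by rewrite /phase muln0 expr0. Qed.

Lemma phase_inj : injective phase.
Proof.
move=> a b /eqP; rewrite (eq_prim_root_expr zetaP) -!muln_modr !modn_small //.
by rewrite eqn_pmul2l // => /eqP/val_inj.
Qed.

Lemma normr_zeta m : `|zeta ^+ m| = 1.
Proof.
rewrite normrX; suff -> : `|zeta| = 1 by rewrite expr1n.
apply/eqP; rewrite -(@pexpr_eq1 _ _ (2 * N)) // -normrX.
by rewrite (prim_expr_order zetaP) normr1.
Qed.

Lemma norm_phase a : `|phase a| = 1.
Proof. exact: normr_zeta. Qed.

Lemma conj_norm1 (z : C) : `|z| = 1 -> z * Num.conj z = 1.
Proof. by move=> z1; rewrite -normCK z1 expr1n. Qed.

Lemma phase_neq0 a : phase a != 0.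
Proof. by rewrite -normr_eq0 norm_phase oner_eq0. Qed.

Lemma sum_phase a : \sum_b phase (a * b) = N%:R *+ (a == 0).
Proof.
have [->|a0] := eqVneq a 0.
  under eq_bigr do rewrite mul0r phase0.
  by rewrite sumr_const card_ord mulr1n.
rewrite mulr0n; set s := \sum_b _.
have : phase a * s = s.
  rewrite [RHS](reindex_inj (addrI 1)) mulr_sumr.
  by apply: eq_bigr => b _; rewrite mulrDr mulr1 phaseD.
move/eqP; rewrite -subr_eq0 -{2}[s]mul1r -mulrBl mulf_eq0 => /orP[|/eqP //].
by rewrite subr_eq0 -phase0 (inj_eq phase_inj) (negPf a0).
Qed.

(** The first coordinate of [v] is the translation, the second the character. *)
Definition weyl_op (v : 'cV['I_N]_2) : 'M[C]_N :=
  weyl (v 0 0) (fun b => phase (v 1 0 * b)).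
Local Notation W := weyl_op.

Definition sympl (u v : 'cV['I_N]_2) : 'I_N := u 1 0 * v 0 0 - v 1 0 * u 0 0.

Lemma weyl_opE v i b : W v i b = phase (v 1 0 * b) *+ (i == v 0 0 + b).
Proof. by rewrite mxE. Qed.

Lemma mulmx_weyl_op m (A : 'M[C]_(m, N)) v i b :
  (A *m W v) i b = phase (v 1 0 * b) * A i (v 0 0 + b).
Proof.
rewrite mxE (bigD1 (v 0 0 + b)) //= weyl_opE eqxx mulr1n big1 ?addr0 1?mulrC //.
by move=> j /negPf jE; rewrite weyl_opE jE mulr0.
Qed.

Lemma weyl_op_mulmx m (A : 'M[C]_(N, m)) v i b :
  (W v *m A) i b = phase (v 1 0 * (i - v 0 0)) * A (i - v 0 0) b.
Proof.
rewrite mxE (bigD1 (i - v 0 0)) //= weyl_opE subrKC eqxx mulr1n big1 ?addr0 //.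
move=> j jE; rewrite weyl_opE; case: eqP => [iE|]; last by rewrite mul0r.
by rewrite iE addrC addKr eqxx in jE.
Qed.

Lemma weyl_op_mul u v : W u *m W v = phase (u 1 0 * v 0 0) *: W (u + v).
Proof.
apply/matrixP => i b; rewrite mulmx_weyl_op weyl_opE [RHS]mxE weyl_opE !mxE addrA.
case: eqP => _; last by rewrite !mulr0n !mulr0.
by rewrite !mulr1n -!phaseD; congr phase; ring.
Qed.

Lemma weyl_op_comm u v : W u *m W v = phase (sympl u v) *: (W v *m W u).
Proof.
rewrite !weyl_op_mul scalerA -phaseD addrC; congr (phase _ *: _).
by rewrite /sympl; ring.
Qed.

Lemma weyl_op0 : W 0 = 1%:M.
Proof. by apply/matrixP => i b; rewrite weyl_opE !mxE mul0r phase0 add0r. Qed.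

Lemma trace_weyl_op v : \tr (W v) = N%:R *+ (v == 0).
Proof.
rewrite /mxtrace; under eq_bigr do rewrite weyl_opE -{1}[X in X == _]add0r (inj_eq (addIr _)).
rewrite sumrMnl sum_phase -mulrnA; congr (_ *+ _).
have -> : (v == 0) = (v 1 0 == 0) && (v 0 0 == 0); last by rewrite mulnb [0 == _]eq_sym.
apply/eqP/andP => [->|[/eqP v1 /eqP v0]]; first by rewrite !mxE.
by apply: cV2_eq; rewrite mxE.
Qed.

Lemma phase_character k : is_character (fun b => phase (k * b)).
Proof. by split=> [a|a b]; [exact: norm_phase | rewrite mulrDr phaseD]. Qed.

Lemma character_phase (chi : 'I_N -> C) :
  is_character chi -> exists k, chi =1 (fun b => phase (k * b)).
Proof.
move=> [chi1 chiD].
have chi0 : chi 0 = 1.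
  have c0 : chi 0 != 0 by rewrite -normr_eq0 chi1 oner_eq0.
  by apply: (mulfI c0); rewrite -chiD addr0 mulr1.
have chiX m : chi m%:R = chi 1 ^+ m.
  by elim: m => // m IHm; rewrite -natr1 chiD IHm exprSr.
have N0 : N%:R = 0 :> 'I_N by rewrite Zp_nat; apply/val_inj; exact: modnn.
have omegaP : N.-primitive_root (zeta ^+ 2).
  by have := dvdn_prim_root zetaP (dvdn_mull 2 (dvdnn N)); rewrite mulnK.
have [k kE] := prim_rootP omegaP (etrans (esym (chiX N)) (etrans (congr1 chi N0) chi0)).
exists k => b; rewrite -[b in LHS]natr_Zp chiX kE -!exprM.
by apply: phase_nat; rewrite /= modn_mod.
Qed.

Lemma heisenbergP (M : 'M[C]_N) :
  heisenberg M <-> exists z v, `|z| = 1 /\ M = z *: W v.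
Proof.
split=> [[z [a [chi [z1 /character_phase[k chiE] ->]]]]|[z [v [z1 ->]]]].
  exists z, (\col_i (if i == 0 then a else k)); split=> //; congr (_ *: _).
  by apply/matrixP => i b; rewrite weyl_opE !mxE chiE.
by exists z, (v 0 0), (fun b => phase (v 1 0 * b)); split=> //; apply: phase_character.
Qed.

Lemma weyl_op_neq0 v : W v != 0.
Proof.
apply/eqP => /matrixP/(_ (v 0 0) 0)/eqP; rewrite weyl_opE mxE addr0 eqxx mulr1n.
exact/negP/phase_neq0.
Qed.

(** The product W_(-v) W_u is a nonzero multiple of W_(u - v), whose trace
    vanishes unless u = v. *)
Lemma weyl_op_inj c u v : W u = c *: W v -> u = v.
Proof.
move=> Wuv; apply/eqP; rewrite -subr_eq0; apply/eqP.
have : \tr (W (- v) *m W u) != 0.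
  have c0 : c != 0.
    by apply: contraNneq (weyl_op_neq0 u) => c0; rewrite Wuv c0 scale0r.
  rewrite Wuv -scalemxAr weyl_op_mul addNr !linearZ /= trace_weyl_op eqxx mulr1n.
  by rewrite !mulf_neq0 ?phase_neq0 ?pnatr_eq0.
rewrite weyl_op_mul linearZ /= trace_weyl_op [- v + u]addrC; case: (u - v =P 0) => // _.
by rewrite mulr0n mulr0 eqxx.
Qed.

(** Conjugation by [U] acts on the Weyl operators, up to phases, as the linear
    map [g] of the plane. *)
Definition implements (U : 'M[C]_N) (g : 'M['I_N]_2) :=
  U \is unitarymx /\
  forall v, exists2 c, `|c| = 1 & U *m W v = c *: (W (g *m v) *m U).

Lemma implements_mul U1 g1 U2 g2 :
  implements U1 g1 -> implements U2 g2 -> implements (U1 *m U2) (g1 *m g2).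
Proof.
move=> [uU1 iU1] [uU2 iU2]; split=> [|v]; first exact: mul_unitarymx.
have [c2 c2_1 E2] := iU2 v; have [c1 c1_1 E1] := iU1 (g2 *m v).
exists (c1 * c2); first by rewrite normrM c1_1 c2_1 mulr1.
rewrite -mulmxA E2 -scalemxAr [U1 *m (_ *m U2)]mulmxA E1 -scalemxAl scalerA -!mulmxA.
by rewrite [c2 * c1]mulrC.
Qed.

Lemma unit_conj (U M M' : 'M[C]_N) :
  U \is unitarymx -> (U *m M *m invmx U = M') <-> (U *m M = M' *m U).
Proof.
move=> /unitarymx_unit uU; split=> [<-|->]; first by rewrite mulmxKV.
by rewrite mulmxK.
Qed.

Lemma implements_normalizer U g :
  g \in unitmx -> implements U g -> clifford_normalizer U.
Proof.
move=> ug [uU iU]; split=> //; apply/seteqP; split=> M /=.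
  move=> [_ /heisenbergP[z [v [z1 ->]]] <-]; apply/heisenbergP.
  have [c c1 E] := iU v; exists (z * c), (g *m v).
  split; first by rewrite normrM z1 c1 mulr1.
  by apply/unit_conj => //; rewrite -scalemxAr E scalerA -scalemxAl.
move=> /heisenbergP[z [v [z1 ->]]]; have [c c1 E] := iU (invmx g *m v).
have c0 : c != 0 by rewrite -normr_eq0 c1 oner_eq0.
exists ((z / c) *: W (invmx g *m v)).
  apply/heisenbergP; exists (z / c), (invmx g *m v).
  by rewrite normrM normfV z1 c1 invr1 mulr1.
apply/unit_conj => //; rewrite -scalemxAr E mulKVmx // scalerA divfK //.
by rewrite scalemxAl.
Qed.

Lemma implements_weyl_op u : implements (W u) 1%:M.
Proof.
split=> [|v]; last first.
  by exists (phase (sympl u v)); rewrite ?norm_phase // mul1mx weyl_op_comm.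
apply/unitarymxP/matrixP => i j; rewrite weyl_op_mulmx !mxE.
rewrite subrKC rmorphMn /= mulrnAr conj_norm1 ?norm_phase //.
by rewrite eq_sym.
Qed.

Lemma det2 (g : 'M['I_N]_2) : \det g = g 0 0 * g 1 1 - g 1 0 * g 0 1.
Proof.
rewrite (expand_det_col g 0) 2!big_ord_recl big_ord0 addr0 /cofactor !det_mx11 !mxE /=.
have l0 : lift 0 0 = 1 :> 'I_2 by apply/val_inj.
have l1 : lift 1 0 = 0 :> 'I_2 by apply/val_inj.
rewrite !l0 !l1 /= expr0 mul1r expr1; ring.
Qed.

(** The map s induced on the plane is additive because W_u W_v is a multiple of
    W_(u + v), hence linear over Z/N.  It preserves the symplectic form because
    the commutator of W_u and W_v is a scalar, unchanged by conjugation; in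
    dimension two this means determinant 1. *)
Lemma normalizer_implements U :
  clifford_normalizer U -> exists2 g, \det g = 1 & implements U g.
Proof.
move=> [uU conjU].
have /choice[sc sP] v : exists wc : 'cV['I_N]_2 * C,
    `|wc.2| = 1 /\ U *m W v = wc.2 *: (W wc.1 *m U).
  have : heisenberg (U *m W v *m invmx U).
    rewrite -conjU; exists (W v) => //; apply/heisenbergP.
    by exists 1, v; rewrite normr1 scale1r.
  move=> /heisenbergP[c [w [c1 /(unit_conj _ _ uU) E]]]; exists (w, c).
  by split=> //=; rewrite E scalemxAl.
pose s v := (sc v).1; pose c v := (sc v).2.
have c0 v : c v != 0 by rewrite -normr_eq0 (proj1 (sP v)) oner_eq0.
have UW v : U *m W v = c v *: (W (s v) *m U) := proj2 (sP v).
have cancelU a b u v : a != 0 -> a *: (W u *m U) = b *: (W v *m U) ->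
    u = v /\ a = b.
  move=> a0 /(congr1 (fun M => a^-1 *: (M *m invmx U))).
  rewrite -!scalemxAl !mulmxK ?unitarymx_unit // !scalerA mulVf // scale1r.
  move=> E; have uv := weyl_op_inj E; split=> //; move: E; rewrite uv.
  move=> /eqP; rewrite -{1}[W v]scale1r -subr_eq0 -scalerBl scaler_eq0.
  rewrite (negPf (weyl_op_neq0 v)) orbF subr_eq0 eq_sym => /eqP ab.
  by rewrite -[a]mulr1 -ab mulVKf.
have UWW u v : U *m (W u *m W v) =
    (c u * c v * phase (s u 1 0 * s v 0 0)) *: (W (s u + s v) *m U).
  rewrite mulmxA UW -scalemxAl -mulmxA UW -scalemxAr scalerA mulmxA weyl_op_mul.
  by rewrite -scalemxAl scalerA.
have sD u v : s (u + v) = s u + s v.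
  have := UWW u v; rewrite weyl_op_mul -scalemxAr UW scalerA => /cancelU[] //.
  by rewrite mulf_neq0 ?phase_neq0.
have sS u v : sympl (s u) (s v) = sympl u v.
  have := UWW u v; rewrite weyl_op_comm -scalemxAr UWW addrC scalerA => /cancelU[].
    by rewrite !mulf_neq0 ?phase_neq0.
  move=> _ /eqP; rewrite [c v * _]mulrC mulrCA (inj_eq (mulfI _)) ?mulf_neq0 //.
  rewrite -phaseD (inj_eq phase_inj) => /eqP /(canRL (addrK _)) ->.
  exact: erefl.
have sMn u k : s (u *+ k) = s u *+ k.
  elim: k => [|k IHk]; last by rewrite !mulrSr sD IHk.
  by apply: (addIr (s 0)); rewrite !mulr0n -sD !add0r.
have sZ a u : s (a *: u) = a *: s u.
  by rewrite -[a]natr_Zp !scaler_nat sMn.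
pose e (i : 'I_2) : 'cV['I_N]_2 := delta_mx i 0.
pose g : 'M['I_N]_2 := \matrix_(i, j) s (e j) i 0.
have sE v : s v = g *m v.
  have -> : v = v 0 0 *: e 0 + v 1 0 *: e 1.
    by apply: cV2_eq; rewrite !mxE /= ?mulr0 ?mulr1 ?addr0 ?add0r.
  rewrite sD !sZ mulmxDr -!scalemxAr; congr (_ *: _ + _ *: _);
    by apply/matrixP => i j; rewrite -colE ord1 !mxE.
exists g; last first.
  split=> // v; exists (c v); first by case: (sP v).
  by rewrite UW sE.
have := sS (e 1) (e 0); rewrite /sympl => sg.
rewrite det2 ![g _ _]mxE [X in X - _]mulrC sg !mxE /=.
by rewrite mul0r mulr1 subr0.
Qed.

Lemma conj_phase a : Num.conj (phase a) = phase (- a).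
Proof.
by apply: (mulfI (phase_neq0 a)); rewrite conj_norm1 ?norm_phase // -phaseD subrr phase0.
Qed.

(** * Realising the special linear group *)
Definition fourier : 'M[C]_N :=
  \matrix_(i, j) ((sqrtC N%:R)^-1 * phase (i * j)).

Definition fourier_sympl : 'M['I_N]_2 :=
  \matrix_(i, j) (if i == j then 0 else if i == 0 then -1 else 1).

Lemma implements_fourier : implements fourier fourier_sympl.
Proof.
have N_gt0 : 0 < N%:R :> C by rewrite ltr0n.
split=> [|v].
  apply/unitarymxP/matrixP => i l; rewrite !mxE.
  under eq_bigr => j _.
    rewrite !mxE rmorphM /= conj_phase mulrACA -normCK normfV -phaseD -mulNr -mulrDl.
    over.
  rewrite -mulr_sumr sum_phase subr_eq0 ger0_norm ?sqrtC_ge0 ?ltW // exprVn sqrtCK.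
  by rewrite mulrnAr mulVf // lt0r_neq0.
exists (phase (- (v 1 0 * v 0 0))); first exact: norm_phase.
have [g0 g1] : (fourier_sympl *m v) 0 0 = - v 1 0 /\ (fourier_sympl *m v) 1 0 = v 0 0.
  by rewrite !mxE !sum2E !mxE /=; split; ring.
apply/matrixP => i b; rewrite mulmx_weyl_op [RHS]mxE weyl_op_mulmx g0 g1 !mxE.
rewrite ![_ * (_^-1 * _)]mulrCA -!phaseD; congr (_ * phase _); ring.
Qed.

(** The exponent b (b + N) modulo 2N depends on b modulo N only, whatever the
    parity of N, so that this is a function on Z/N. *)
Definition quadratic : 'M[C]_N := diag_mx (\row_b zeta ^+ (b * (b + N))).

Definition quadratic_sympl : 'M['I_N]_2 :=
  \matrix_(i, j) (if (i == 0) && (j == 1) then 0 else 1).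

Lemma zeta_quadratic m k : m = k %[mod N] -> 
  zeta ^+ (m * (m + N)) = zeta ^+ (k * (k + N)).
Proof.
wlog le_km : m k / (k <= m)%N => [IH mk|].
  by case: (leqP k m) => [|/ltnW] /IH; [apply | move=> ->].
move/eqP; rewrite eqn_mod_dvd // => /dvdnP[d] /eqP.
rewrite -(eqn_add2r k) subnK // => /eqP ->; apply/eqP.
rewrite (eq_prim_root_expr zetaP).
(* The difference of the two exponents is 2 N d k + N^2 d (d + 1). *)
have dd : (d * d.+1 = 2 * (d * d.+1)./2)%N.
  by rewrite mul2n -[LHS]odd_double_half oddM /= andbN.
set q := (d * d.+1)./2 in dd.
have -> : ((d * N + k) * (d * N + k + N) =
    (d * k + N * q) * (2 * N) + k * (k + N))%N.
  transitivity (N * N * (d * d.+1) + 2 * N * d * k + k * (k + N))%N; first ring.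
  by rewrite dd; ring.
by rewrite modnMDl.
Qed.

Lemma quadraticD (a b : 'I_N) :
  zeta ^+ ((a + b)%R * ((a + b)%R + N)) =
  zeta ^+ (a * (a + N)) * zeta ^+ (b * (b + N)) * phase (a * b).
Proof.
rewrite (@zeta_quadratic _ (a + b)%N); last by rewrite /= modn_mod.
rewrite -(@phase_nat (a * b)%N) /= ?modn_mod // -!exprD.
by congr (_ ^+ _); ring.
Qed.

Lemma implements_quadratic : implements quadratic quadratic_sympl.
Proof.
split=> [|v].
  apply/unitarymxP/matrixP => i j; rewrite mul_diag_mx !mxE rmorphMn /=.
  rewrite mulrnAr eq_sym; case: eqP => [->|]; last by rewrite !mulr0n.
  by rewrite conj_norm1 ?normr_zeta.
exists (zeta ^+ (v 0 0 * (v 0 0 + N))); first exact: normr_zeta.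
have [g0 g1] : (quadratic_sympl *m v) 0 0 = v 0 0 /\
    (quadratic_sympl *m v) 1 0 = v 0 0 + v 1 0.
  by rewrite !mxE !sum2E !mxE /=; split; ring.
apply/matrixP => i b; rewrite mulmx_weyl_op [RHS]mxE weyl_op_mulmx g0 g1 !mxE.
rewrite subr_eq [b + _]addrC; case: eqP => [->|]; last by rewrite !mulr0n !mulr0.
have -> : v 0 0 + b - v 0 0 = b by rewrite addrC addKr.
rewrite !mulr1n quadraticD mulrDl phaseD; ring.
Qed.

Lemma mx2_eq (g h : 'M['I_N]_2) :
  [/\ g 0 0 = h 0 0, g 0 1 = h 0 1, g 1 0 = h 1 0 & g 1 1 = h 1 1] -> g = h.
Proof.
move=> [e00 e01 e10 e11]; apply/matrixP => i j.
by case: (ord2E i) => ->; case: (ord2E j) => ->.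
Qed.

Definition implementable g := exists U, implements U g.

Lemma implementable_mul g h :
  implementable g -> implementable h -> implementable (g *m h).
Proof. by move=> [U iU] [V iV]; exists (U *m V); apply: implements_mul. Qed.

Definition lower (s : 'I_N) : 'M['I_N]_2 :=
  \matrix_(i, j) (if i == j then 1 else if i == 0 then 0 else s).
Definition upper (s : 'I_N) : 'M['I_N]_2 :=
  \matrix_(i, j) (if i == j then 1 else if i == 0 then s else 0).

Lemma implementable_lower s : implementable (lower s).
Proof.
rewrite -[s]natr_Zp; elim: {s}(s : nat) => [|k IHk].
  have -> : lower 0 = 1%:M by apply: mx2_eq; rewrite !mxE.
  by exists (W 0); apply: implements_weyl_op.
have -> : lower k.+1%:R = quadratic_sympl *m lower k%:R.
  apply: mx2_eq; rewrite !mxE !sum2E !mxE /= -natr1; split; ring.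
apply: implementable_mul IHk.
by exists quadratic; apply: implements_quadratic.
Qed.

Lemma implementable_fourier : implementable fourier_sympl.
Proof. by exists fourier; apply: implements_fourier. Qed.

Lemma fourier_sympl_sqr : fourier_sympl *m fourier_sympl = - 1%:M.
Proof. by apply: mx2_eq; rewrite !(mxE, sum2E) /=; split; ring. Qed.

Lemma implementable_upper s : implementable (upper s).
Proof.
have -> : upper s = fourier_sympl *m lower (- s) *m
    (fourier_sympl *m (fourier_sympl *m fourier_sympl)).
  rewrite fourier_sympl_sqr mulmxN mulmx1.
  by apply: mx2_eq; rewrite !(mxE, sum2E) /=; split; ring.
have F := implementable_fourier; have L := implementable_lower (- s).
exact: implementable_mul (implementable_mul F L)
  (implementable_mul F (implementable_mul F F)).
Qed.

Hypothesis local_N : forall x : 'I_N, (x \is a GRing.unit) || (1 - x \is a GRing.unit).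

(** If the lower left entry c is a unit, the matrix is a product
    upper * lower c * upper.  Otherwise, Z/N being local, the upper left entry is
    a unit, and the Fourier matrix moves it to the lower left corner. *)
Lemma implementable_det1 g : \det g = 1 -> implementable g.
Proof.
wlog u10 : g / g 1 0 \is a GRing.unit => [IH dg|].
  have [|/negPf nu10] := boolP (g 1 0 \is a GRing.unit); first by move=> /IH; apply.
  have F := implementable_fourier.
  (* The Fourier matrix has order 4. *)
  have -> : g = fourier_sympl *m (fourier_sympl *m (fourier_sympl *m
      (fourier_sympl *m g))).
    rewrite !(mulmxA fourier_sympl fourier_sympl) fourier_sympl_sqr.
    by rewrite !mulNmx !mul1mx opprK.
  apply: implementable_mul F (implementable_mul F (implementable_mul F _)).
  apply: IH; last first.
    by rewrite det_mulmx dg mulr1 det2 !mxE /=; ring.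
  rewrite mxE sum2E !mxE /= mul1r mul0r addr0.
  have := local_N (g 0 0 * g 1 1); rewrite unitrM.
  have -> : 1 - g 0 0 * g 1 1 = - (g 1 0 * g 0 1) by rewrite -dg det2; ring.
  by rewrite unitrN unitrM nu10 orbF => /andP[].
rewrite det2 => dg; set c := g 1 0 in u10 dg.
have -> : g = upper ((g 0 0 - 1) / c) *m lower c *m upper ((g 1 1 - 1) / c).
  apply: mx2_eq; rewrite !(mxE, sum2E) /= -/c.
  split.
  - by rewrite -[g 0 0 in LHS](subrK 1) -[X in X + _ = _](divrK u10); ring.
  - apply: (mulIr u10).
    have -> : g 0 1 * c = g 0 0 * g 1 1 - 1 by rewrite -dg; ring.
    set x := (g 0 0 - 1) / c; set y := (g 1 1 - 1) / c.
    have -> : g 0 0 = x * c + 1 by rewrite divrK // subrK.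
    have -> : g 1 1 = y * c + 1 by rewrite divrK // subrK.
    ring.
  - by rewrite -/c; ring.
  by rewrite -[g 1 1 in LHS](subrK 1) -[X in X + _ = _](divrK u10); ring.
have L := implementable_lower; have U := implementable_upper.
exact: implementable_mul (implementable_mul (U _) (L _)) (U _).
Qed.

End Weyl.

(** * Tensor products of Weyl operators *)
Section TensorPower.
Variables (R : realType) (n t : nat).
Local Notation C := R[i].
Local Notation N := n.+2.
Local Notation D := (tensor_dim n.+1 t).

Definition tens (A : 'I_t -> 'M[C]_N) : 'M[C]_D :=
  \matrix_(x, y) \prod_k
    A k ((enum_val x : {ffun 'I_t -> 'I_N}) k)
        ((enum_val y : {ffun 'I_t -> 'I_N}) k).

Lemma tens_mul A B : tens A *m tens B = tens (fun k => A k *m B k).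
Proof.
apply/matrixP => x y; rewrite !mxE; under [RHS]eq_bigr do rewrite mxE.
rewrite bigA_distr_bigA /= [RHS](reindex _ (onW_bij _ (enum_val_bij _))) /=.
by apply: eq_bigr => z _; rewrite !mxE -big_split.
Qed.

Lemma eq_tens A B : A =1 B -> tens A = tens B.
Proof. by move=> AB; apply/matrixP => x y; rewrite !mxE; apply: eq_bigr => k _; rewrite AB. Qed.

Lemma tens_scale (c : 'I_t -> C) A :
  tens (fun k => c k *: A k) = (\prod_k c k) *: tens A.
Proof.
by apply/matrixP => x y; rewrite !mxE -big_split /=; apply: eq_bigr => k _; rewrite mxE.
Qed.

Lemma trace_tens A : \tr (tens A) = \prod_k \tr (A k).
Proof.
rewrite /mxtrace bigA_distr_bigA /= [RHS](reindex _ (onW_bij _ (enum_val_bij _))) /=.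
by apply: eq_bigr => x _; rewrite mxE.
Qed.

Lemma tens_unitary U : U \is unitarymx -> tens (fun=> U) \in unitmx.
Proof.
move=> /unitarymxP UU; apply: (proj1 (@mulmx1_unit _ _ _ (tens (fun=> (U^t*)%sesqui)) _)).
rewrite tens_mul (eq_tens (fun=> UU)); apply/matrixP => x y; rewrite !mxE.
case: eqVneq => [->|neq_xy]; first by rewrite big1 // => k _; rewrite mxE eqxx.
have [k neq_k] : exists k, (enum_val x : {ffun 'I_t -> 'I_N}) k != (enum_val y : {ffun 'I_t -> 'I_N}) k.
  apply/existsP; apply: contraNT neq_xy; rewrite negb_exists => /forallP eqxy.
  by apply/eqP/enum_val_inj/ffunP => k; apply/eqP/negPn.
by rewrite (bigD1 k) //= mxE (negPf neq_k) mul0r.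
Qed.

Variable zeta : C.
Hypothesis zetaP : (2 * N).-primitive_root zeta.
Local Notation W := (weyl_op zeta).

Definition weyl_tensor (M : 'M['I_N]_(2, t)) : 'M[C]_D := tens (fun k => W (col k M)).

Lemma weyl_tensor_mul M M' : exists2 c, c != 0 & weyl_tensor M *m weyl_tensor M' = c *: weyl_tensor (M + M').
Proof.
exists (\prod_k phase zeta ((col k M) 1 0 * (col k M') 0 0)).
  by apply/prodf_neq0 => k _; apply: phase_neq0.
rewrite tens_mul -tens_scale; apply: eq_tens => k.
by rewrite weyl_op_mul // linearD.
Qed.

Lemma trace_weyl_tensor M : (\tr (weyl_tensor M) != 0) = (M == 0).
Proof.
rewrite trace_tens; under eq_bigr do rewrite trace_weyl_op //.
apply/prodf_neq0/eqP => [M0|-> k _]; last first.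
  by rewrite linear0 eqxx pnatr_eq0.
apply/matrixP => i k; rewrite mxE; have := M0 k isT.
by case: (col k M =P 0) => [/matrixP/(_ i 0)|_]; rewrite ?eqxx // !mxE.
Qed.

Lemma weyl_tensor_independent : independent weyl_tensor.
Proof.
move=> x x0 M; have [d d0 dE] := weyl_tensor_mul (- M) M.
have : \tr (weyl_tensor (- M) *m \sum_M' x M' *: weyl_tensor M') = 0 by rewrite x0 mulmx0 mxtrace0.
rewrite mulmx_sumr linear_sum (bigD1 M) //= big1 ?addr0 => [|M' neqM].
  rewrite -scalemxAr dE !linearZ /= addNr => /eqP; rewrite !mulf_eq0 (negPf d0).
  by have := trace_weyl_tensor 0; rewrite eqxx => /negPf ->; rewrite !orbF => /eqP.
have [c _ E] := weyl_tensor_mul (- M) M'; rewrite -scalemxAr E !linearZ /=.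
have := trace_weyl_tensor (- M + M'); rewrite addrC subr_eq0 (negPf neqM) => /negbFE/eqP ->.
by rewrite !mulr0.
Qed.

Lemma weyl_tensor_span (X : 'M[C]_D) : exists x, X = \sum_M x M *: weyl_tensor M.
Proof.
apply: independent_span weyl_tensor_independent _.
rewrite card_mx dimvf /dim /= /tensor_dim card_ffun !card_ord.
by rewrite -expnD addnn mul2n.
Qed.

(** The same scalar appears in the tensor product and in the ordered product,
    which is what makes the phases cancel in [tensor_power_weyl_normalized]. *)
Lemma tensor_power_weyl_tensor U g M : implements zeta U g ->
  exists2 c, tensor_power t U *m weyl_tensor M = c *: (weyl_tensor (g *m M) *m tensor_power t U) &
    U *m (\prod_k W (col k M)) = c *: ((\prod_k W (col k (g *m M))) *m U).
Proof.
move=> [_ iU]; have /choice[c cP] k : exists c,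
    U *m W (col k M) = c *: (W (col k (g *m M)) *m U).
  by have [c _ E] := iU (col k M); exists c; rewrite E !colE mulmxA.
exists (\prod_k c k).
  rewrite !tens_mul -tens_scale; exact: eq_tens.
elim/big_rec3: _ => [|k P d Q _ IH]; first by rewrite scale1r mul1mx mulmx1.
rewrite -!mulmxE mulmxA cP -scalemxAl -[_ *m U *m Q]mulmxA IH -scalemxAr scalerA.
by rewrite mulmxA.
Qed.

Lemma prod_weyl_op (f : 'I_t -> 'cV['I_N]_2) :
  exists2 c, c != 0 & \prod_k W (f k) = c *: W (\sum_k f k).
Proof.
elim/big_rec2: _ => [|k v P _ [c c0 ->]].
  by exists 1; rewrite ?oner_eq0 // scale1r weyl_op0.
rewrite -mulmxE -scalemxAr; have -> := weyl_op_mul zetaP (f k) v; rewrite scalerA.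
by eexists; last reflexivity; rewrite mulf_neq0 // phase_neq0.
Qed.

Definition zero_sum (M : 'M['I_N]_(2, t)) := \sum_k col k M == 0.

(** For a zero-sum tuple the ordered product is a scalar matrix, so that any
    diagonal entry is the scalar. *)
Definition scalar_of (M : 'M['I_N]_(2, t)) : C := (\prod_k W (col k M)) 0 0.

Lemma scalar_ofP M : zero_sum M ->
  scalar_of M != 0 /\ \prod_k W (col k M) = (scalar_of M)%:M.
Proof.
move=> /eqP M0; rewrite /scalar_of; have [c c0] := prod_weyl_op (fun k => col k M).
by rewrite M0 weyl_op0 // => ->; rewrite scalemx1 !mxE eqxx mulr1n.
Qed.

Lemma zero_sum_mul g M : zero_sum M -> zero_sum (g *m M).
Proof.
move=> /eqP M0; rewrite /zero_sum; under eq_bigr do rewrite colE -mulmxA -colE.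
by rewrite -mulmx_sumr M0 mulmx0.
Qed.

Definition weyl_normalized (M : 'M['I_N]_(2, t)) : 'M[C]_D := (scalar_of M)^-1 *: weyl_tensor M.

(** Conjugation by [U] takes the tensor product for [M] to c times the one for
    [g *m M], and the ordered product likewise with the same c.  The latter is a
    scalar matrix, which conjugation fixes, so its value for [M] is c times its
    value for [g *m M]. *)
Lemma tensor_power_weyl_normalized U g M : implements zeta U g -> zero_sum M ->
  tensor_power t U *m weyl_normalized M = weyl_normalized (g *m M) *m tensor_power t U.
Proof.
move=> iU M0; have [s0 sE] := scalar_ofP M0.
have [s0' sE'] := scalar_ofP (zero_sum_mul g M0).
have [c cT] := tensor_power_weyl_tensor M iU; rewrite sE sE'.
rewrite mul_mx_scalar mul_scalar_mx scalerA => cU.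
have U0 : U != 0.
  case: iU => /unitarymx_unit uU _; apply: contraTneq uU => ->.
  by rewrite unitmxE det0 // unitr0.
have {cU}sc : scalar_of M = c * scalar_of (g *m M).
  apply/eqP; rewrite -subr_eq0; have /eqP := cU.
  by rewrite -subr_eq0 -scalerBl scaler_eq0 (negPf U0) orbF.
rewrite -scalemxAr cT scalerA -scalemxAl sc; congr (_ *: _).
rewrite invfM mulrAC mulVf ?mul1r //.
by apply: contraNneq s0; rewrite sc => ->; rewrite mul0r.
Qed.

Lemma commutes_cliffordP (X : 'M[C]_D) : commutes_clifford X <->
  forall U g, \det g = 1 -> implements zeta U g ->
    X *m tensor_power t U = tensor_power t U *m X.
Proof.
split=> [XU U g dg iU|XU _ [U nU <-] _ [z z1 <-]].
  have nU : clifford_normalizer U.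
    by apply: (implements_normalizer zetaP _ iU); rewrite unitmxE dg unitr1.
  apply: (XU (classical_sets.image (@U1 R) (fun z => z *: U))); first by exists U.
  by exists 1; rewrite /U1 /= ?normr1 // scale1r.
have [g dg iU] := normalizer_implements zetaP nU.
have -> : tensor_power t (z *: U) = (\prod_(k < t) z) *: tensor_power t U.
  by rewrite -(tens_scale (fun=> z)).
by rewrite -scalemxAr -scalemxAl (XU U g).
Qed.

(** A diagonal Weyl operator multiplies the tensor product indexed by [M] by a
    character of the column sum of [M], and the symplectic form is
    nondegenerate. *)
Lemma commute_weyl_zero_sum (y : 'M['I_N]_(2, t) -> C) :
  commutes_clifford (\sum_M y M *: weyl_tensor M) -> forall M, ~~ zero_sum M -> y M = 0.
Proof.
move=> /commutes_cliffordP yC M Mn0; set s := \sum_k col k M in Mn0.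
have twist u M' : tensor_power t (W u) *m weyl_tensor M' =
    phase zeta (sympl u (\sum_k col k M')) *: (weyl_tensor M' *m tensor_power t (W u)).
  rewrite !tens_mul; have -> : phase zeta (sympl u (\sum_k col k M')) =
      \prod_k phase zeta (sympl u (col k M')).
    elim/big_rec2: _ => [|k c v _ <-]; last first.
      rewrite -(phaseD zetaP); congr phase; rewrite /sympl !mxE; ring.
    by rewrite -(@phase0 R n zeta) /sympl !mxE; congr phase; ring.
  by rewrite -tens_scale; apply: eq_tens => k; apply: weyl_op_comm.
have y0 u : phase zeta (sympl u s) != 1 -> y M = 0.
  move=> ph1; have iW := implements_weyl_op zetaP u.
  have := yC (W u) 1%:M (det1 _ _) iW; rewrite mulmx_suml mulmx_sumr.
  move/eqP; rewrite -subr_eq0 -sumrB.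
  under eq_bigr => M' _ do rewrite -scalemxAr twist scalerA -scalemxAl -scalerBl scalemxAl.
  rewrite -mulmx_suml => /eqP /(congr1 (mulmx^~ (invmx (tens (fun=> W u))))).
  rewrite mulmxK ?tens_unitary ?(proj1 iW) // mul0mx => /weyl_tensor_independent /(_ M) /eqP.
  rewrite -/s -{1}[y M]mulr1 -mulrBr mulf_eq0 subr_eq0 [1 == _]eq_sym (negPf ph1) orbF.
  by move/eqP.
have ph_neq1 (a : 'I_N) : a != 0 -> phase zeta a != 1.
  by apply: contra_neq => a1; apply: (phase_inj zetaP); rewrite a1 phase0.
have [s0|s0] := eqVneq (s 0 0) 0; last first.
  apply: (y0 (delta_mx 1 0)); apply: ph_neq1.
  by rewrite /sympl !mxE /= mul1r mulr0 subr0.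
apply: (y0 (delta_mx 0 0)); apply: ph_neq1.
rewrite /sympl !mxE /= mul0r mulr1 sub0r oppr_eq0; apply: contra_neq Mn0 => s1.
by apply: cV2_eq; rewrite ?s0 ?s1 mxE.
Qed.

End TensorPower.

(** * The commutant and the orbits of the special linear group *)
Section Commutant.
Variables (R : realType) (n m : nat).
Local Notation C := R[i].
Local Notation N := n.+2.

Variable zeta : C.
Hypothesis zetaP : (2 * N).-primitive_root zeta.
Local Notation W := (weyl_op zeta).

(** Right multiplication by this matrix appends minus the sum of the columns as
    the last column. *)
Definition zero_sum_ext : 'M['I_N]_(m, m.+1) :=
  \matrix_(i, k) ((k == lift ord_max i)%:R - (k == ord_max)%:R).

Lemma zero_sum_extE a (M : 'M['I_N]_(a, m)) i k :
  (M *m zero_sum_ext) i (lift ord_max k) = M i k.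
Proof.
rewrite mxE (bigD1 k) //= mxE eqxx eq_sym (negPf (neq_lift _ _)) subr0 mulr1.
rewrite big1 ?addr0 // => j /negPf jk; rewrite mxE (inj_eq lift_inj) eq_sym jk.
by rewrite eq_sym (negPf (neq_lift _ _)) subr0 mulr0.
Qed.

Lemma zero_sum_extK a :
  cancel (mulmx^~ zero_sum_ext : 'M['I_N]_(a, m) -> _) (col' ord_max).
Proof. by move=> M; apply/matrixP => i k; rewrite mxE zero_sum_extE. Qed.

Lemma zero_sumE (M : 'M['I_N]_(2, m.+1)) : zero_sum M = (M *m (const_mx 1 : 'cV_m.+1) == 0).
Proof.
congr (_ == _); apply/matrixP => i j; rewrite ord1 summxE !mxE.
by apply: eq_bigr => k _; rewrite !mxE mulr1.
Qed.

Lemma zero_sum_ext_sum (M : 'M['I_N]_(2, m)) : zero_sum (M *m zero_sum_ext).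
Proof.
rewrite zero_sumE -mulmxA; suff -> : zero_sum_ext *m const_mx 1 = 0 :> 'cV_m.
  by rewrite mulmx0.
apply/matrixP => i j; rewrite !mxE; under eq_bigr do rewrite !mxE mulr1.
rewrite sumrB (bigD1 (lift ord_max i)) //= big1 => [|k /negPf -> //].
rewrite (bigD1 ord_max) //= [X in _ - (_ + X)]big1 => [|k /negPf -> //].
by rewrite !eqxx subrr.
Qed.

Lemma zero_sum_ext_onto (M : 'M['I_N]_(2, m.+1)) :
  zero_sum M -> col' ord_max M *m zero_sum_ext = M.
Proof.
move=> M0; apply/eqP; rewrite -subr_eq0; set D := _ - M.
have D_lift i k : D i (lift ord_max k) = 0.
  by rewrite mxE zero_sum_extE !mxE subrr.
have D_sum : D *m (const_mx 1 : 'cV_m.+1) = 0.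
  move: (zero_sum_ext_sum (col' ord_max M)) M0; rewrite !zero_sumE mulmxBl.
  by move=> /eqP -> /eqP ->; rewrite subrr.
clearbody D; apply/eqP/matrixP => i k; rewrite [RHS]mxE.
have [j ->|->] := unliftP ord_max k; first exact: D_lift.
have /matrixP/(_ i 0) := D_sum; rewrite !mxE (bigD1 ord_max) //= mxE mulr1.
rewrite big1 ?addr0 // => j; have [l -> _|->] := unliftP ord_max j; last by rewrite eqxx.
by rewrite D_lift mul0r.
Qed.

Definition sl2_equiv : rel 'M['I_N]_(2, m) :=
  [rel M M' | [exists g, (\det g == 1) && (M' == g *m M)]].

Lemma sl2_equivP M M' :
  reflect (exists2 g, \det g = 1 & M' = g *m M) (sl2_equiv M M').
Proof.
apply: (iffP existsP) => [[g /andP[/eqP ? /eqP ?]]|[g dg ->]]; exists g => //.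
by rewrite dg !eqxx.
Qed.

Lemma sl2_equiv_equivalence : equivalence_rel sl2_equiv.
Proof.
have refl M : sl2_equiv M M by apply/sl2_equivP; exists 1%:M; rewrite ?det1 ?mul1mx.
have trans M2 M1 M3 : sl2_equiv M1 M2 -> sl2_equiv M2 M3 -> sl2_equiv M1 M3.
  move=> /sl2_equivP[g dg ->] /sl2_equivP[h dh ->]; apply/sl2_equivP.
  by exists (h *m g); rewrite ?det_mulmx ?dg ?dh ?mulr1 ?mulmxA.
have sym M1 M2 : sl2_equiv M1 M2 -> sl2_equiv M2 M1.
  move=> /sl2_equivP[g dg ->]; apply/sl2_equivP; exists (invmx g).
    by rewrite det_inv dg invr1.
  by rewrite mulKmx // unitmxE dg unitr1.
by move=> x y z; split=> // xy; apply/idP/idP; apply: trans => //; apply: sym.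
Qed.

Definition orbit_vector (M : 'M['I_N]_(2, m)) := weyl_normalized zeta (M *m zero_sum_ext).

Lemma orbit_vector_independent : independent orbit_vector.
Proof.
apply: (independent_comp (can_inj (@zero_sum_extK 2))) (weyl_tensor_independent zetaP).
by move=> M; rewrite invr_neq0 //; case: (scalar_ofP zetaP (zero_sum_ext_sum M)).
Qed.

Lemma tensor_power_orbit_vector U g x : \det g = 1 -> implements zeta U g ->
  tensor_power m.+1 U *m (\sum_M x M *: orbit_vector M) =
  (\sum_M x (invmx g *m M) *: orbit_vector M) *m tensor_power m.+1 U.
Proof.
move=> dg iU; have ug : g \in unitmx by rewrite unitmxE dg unitr1.
rewrite mulmx_sumr mulmx_suml [RHS](reindex_inj (can_inj (mulKmx ug))) /=.
apply: eq_bigr => M _; rewrite -scalemxAl -scalemxAr /orbit_vector mulKmx //.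
by rewrite (tensor_power_weyl_normalized zetaP iU (zero_sum_ext_sum M)) mulmxA.
Qed.

Hypothesis local_N : forall x : 'I_N, (x \is a GRing.unit) || (1 - x \is a GRing.unit).

(** Clifford unitaries permute the orbit vectors without phases, so commuting
    with them is invariance of the coefficients; every element of SL_2 is needed
    for the converse, whence the assumption that Z/N is local. *)
Lemma mem_commutant_orbits (X : 'M[C]_(tensor_dim n.+1 m.+1)) :
  X \in commutant R n.+1 m.+1 <->
  exists2 x, (forall M M', sl2_equiv M M' -> x M = x M') &
    X = \sum_M x M *: orbit_vector M.
Proof.
apply: (iff_trans (mem_commutant X)); split=> [XC|[x x_inv ->]].
  have [y Xy] := weyl_tensor_span zetaP X.
  have y0 := commute_weyl_zero_sum zetaP (eq_ind _ (@commutes_clifford R _ _) XC _ Xy).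
  pose x (M : 'M['I_N]_(2, m)) := y (M *m zero_sum_ext) * scalar_of zeta (M *m zero_sum_ext).
  have Xx : X = \sum_M x M *: orbit_vector M.
    rewrite Xy (bigID (@zero_sum _ _)) /= [X in _ + X]big1 ?addr0; last first.
      by move=> M /y0 ->; rewrite scale0r.
    rewrite (reindex_onto (mulmx^~ zero_sum_ext) (col' ord_max)) /=; last first.
      exact: zero_sum_ext_onto.
    apply: eq_big => [M|M _]; first by rewrite zero_sum_ext_sum zero_sum_extK eqxx.
    have [s0 _] := scalar_ofP zetaP (zero_sum_ext_sum M).
    by rewrite scalerA mulfK.
  exists x; last exact: Xx.
  move=> M _ /sl2_equivP[g dg ->].
  have [U iU] := implementable_det1 zetaP local_N dg.
  have := proj1 (commutes_cliffordP zetaP X) XC U g dg iU.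
  have uT : tensor_power m.+1 U \in unitmx by apply: tens_unitary; case: iU.
  rewrite Xx (tensor_power_orbit_vector x dg iU) => /(can_inj (mulmxK uT)) /eqP.
  rewrite -subr_eq0 -sumrB.
  under eq_bigr do rewrite -scalerBl.
  move=> /eqP /orbit_vector_independent /(_ (g *m M)) /eqP.
  have ug : g \in unitmx by rewrite unitmxE dg unitr1.
  by rewrite (mulKmx ug) subr_eq0 => /eqP.
apply/(commutes_cliffordP zetaP) => U g dg iU.
rewrite (tensor_power_orbit_vector x dg iU); congr (_ *m _); apply: eq_bigr => M _.
congr (_ *: _); apply/esym/x_inv/sl2_equivP; exists g => //.
by rewrite mulKVmx // unitmxE dg unitr1.
Qed.

Lemma commutant_dim_orbits :
  \dim (commutant R n.+1 m.+1) = #|equivalence_partition sl2_equiv [set: _]|.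
Proof.
exact: invariant_combination_dim sl2_equiv_equivalence orbit_vector_independent
  mem_commutant_orbits.
Qed.

End Commutant.

(** * Orbits of the special linear group on matrices over Z/p^r *)

(** The number of first (and of second) rows of the normal forms with invariants
    [a] and [j]. *)
Definition row_count (p m a j : nat) : rat := (p ^ (a * m.-1 + (m.-1 - j)))%:R.

(** The number of such second rows killed by p^b, for b <= a + 1. *)
Definition torsion_count (p m a j b : nat) : rat :=
  if (b <= a)%N then (p ^ (b * m.-1))%:R else row_count p m a j.

Section OrbitCount.
Variables (p r n m : nat).
Hypothesis p_pr : prime p.
Hypothesis Npr : n.+2 = (p ^ r)%N.
Local Notation N := n.+2.
Let p_gt0 : (0 < p)%N := prime_gt0 p_pr.

(** The elements killed by p^b; for b <= r they are the multiples of
    p^(r - b). *)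
Definition ann (b : nat) : {set 'I_N} := [set y | y *+ p ^ b == 0].

Lemma annE b y : (b <= r)%N -> (y \in ann b) = (p ^ (r - b) %| y)%N.
Proof.
move=> br; rewrite inE Zp_mulrn -val_eqE /= -/(dvdn N _).
have -> : (N %| y * p ^ b)%N = (p ^ r %| y * p ^ b)%N by rewrite -Npr.
rewrite -{1}(subnK br).
by rewrite expnD dvdn_pmul2r // expn_gt0 p_gt0.
Qed.

Lemma ann_le b c y : (b <= c)%N -> y \in ann b -> y \in ann c.
Proof.
rewrite !inE => /subnK <- /eqP y0.
by rewrite expnD mulnC mulrnA y0 mul0rn.
Qed.

Lemma ann_r y : y \in ann r.
Proof. by rewrite annE // subnn dvd1n. Qed.

Lemma ann0 y : (y \in ann 0) = (y == 0).
Proof. by rewrite inE mulr1n. Qed.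

Lemma annM b x y : y \in ann b -> x * y \in ann b.
Proof. by rewrite !inE -mulrnAr => /eqP ->; rewrite mulr0. Qed.

Lemma annD b x y : x \in ann b -> y \in ann b -> x + y \in ann b.
Proof. by rewrite !inE mulrnDl => /eqP -> /eqP ->; rewrite addr0. Qed.

Lemma pr0 : (p ^ r)%:R = 0 :> 'I_N.
Proof. by rewrite -Npr Zp_nat; apply/val_inj; exact: modnn. Qed.

Lemma annP b y : (b <= r)%N -> reflect (exists u, y = (p ^ (r - b))%:R * u) (y \in ann b).
Proof.
move=> br; rewrite annE //; apply: (iffP dvdnP) => [[k yk]|[u ->]].
  by exists k%:R; rewrite -natrM mulnC -yk natr_Zp.
apply/dvdnP; rewrite -annE // inE -mulrnAl -mulrnA -expnD subnK //.
by rewrite pr0 mul0r.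
Qed.

Lemma card_ann b : (b <= r)%N -> #|ann b| = (p ^ b)%N.
Proof.
move=> br; have pb_gt0 k : (0 < p ^ k)%N by rewrite expn_gt0 p_gt0.
have -> : (p ^ b = N %/ p ^ (r - b))%N.
  by rewrite Npr -{1}(subnKC br) expnD mulnK.
rewrite divn_count_dvd -sum1_card big_mkcond /=.
under eq_bigr do rewrite annE //.
transitivity (\sum_(0 <= i < N) (p ^ (r - b) %| i))%N.
  by rewrite big_mkord; apply: eq_bigr => i _; case: dvdn.
rewrite big_ltn // [RHS]big_nat_recr //= addnC dvdn0; congr (_ + _)%N.
by rewrite Npr dvdn_exp2l // leq_subr.
Qed.

Let r_gt0 : (0 < r)%N.
Proof. by move: Npr; case: (r). Qed.

Let sub_pred_r : (r - r.-1 = 1)%N.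
Proof. by rewrite -subn1 subKn. Qed.

(** An element of Z/p^r is either prime to p or a multiple of p. *)
Lemma unit_or_ann (y : 'I_N) : (y \is a GRing.unit) || (y \in ann r.-1).
Proof.
rewrite -[y in y \is a _]natr_Zp (unitZpE y (isT : 1 < N)%N).
rewrite annE ?leq_pred // sub_pred_r expn1.
have -> : coprime N y = coprime (p ^ r) y by rewrite -Npr.
by rewrite coprime_pexpl ?prime_coprime // orNb.
Qed.

Lemma local_Zpr (x : 'I_N) : (x \is a GRing.unit) || (1 - x \is a GRing.unit).
Proof.
have /orP[-> //|xr] := unit_or_ann x.
have /orP[->|xr'] := unit_or_ann (1 - x); first by rewrite orbT.
have := annD xr xr'; rewrite addrC subrK annE ?leq_pred // sub_pred_r expn1.
by rewrite dvdn1 -[_ == _]negbK neq_ltn prime_gt1 ?orbT.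
Qed.

(** The multiples of [z] form the cyclic additive group generated by [z], whose
    order divides a power of p. *)
Lemma card_multiples (z : 'rV['I_N]_m) b : z *+ p ^ b = 0 ->
  exists2 c, #|[set s *: z | s : 'I_N]| = (p ^ c)%N &
    forall k, (z *+ p ^ k == 0) = (c <= k)%N.
Proof.
move=> z0; have orderE k : (#[z]%g %| k)%N = (z *+ k == 0).
  by rewrite order_dvdn FinRing.zmodXgE.
have : (#[z]%g %| p ^ b)%N by rewrite orderE z0.
move=> /(dvdn_pfactor _ _ p_pr)[c _ oz]; exists c => [|k]; last first.
  by rewrite -orderE oz dvdn_Pexp2l // prime_gt1.
rewrite -oz; apply: eq_card => y; apply/imsetP/cycleP => [[s _ ->]|[k ->]].
  by exists s; rewrite FinRing.zmodXgE -{1}[s]natr_Zp scaler_nat.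
by exists k%:R; rewrite // FinRing.zmodXgE scaler_nat.
Qed.

Definition colann (M : 'M['I_N]_(2, m)) i b := (M 0 i \in ann b) && (M 1 i \in ann b).

Lemma colann_mul g M i b : colann M i b -> colann (g *m M) i b.
Proof. by case/andP => M0 M1; apply/andP; rewrite !mxE !sum2E !annD ?annM. Qed.

Lemma colann_sl2 g M i b : \det g = 1 -> colann (g *m M) i b = colann M i b.
Proof.
move=> dg; apply/idP/idP => [/(colann_mul (invmx g))|]; last exact: colann_mul.
by rewrite mulKmx // unitmxE dg unitr1.
Qed.

Lemma colann_le M i b c : (b <= c)%N -> colann M i b -> colann M i c.
Proof. by move=> bc /andP[M0 M1]; rewrite /colann !(ann_le bc). Qed.

Definition pivot a : 'I_N := (p ^ (r - a.+1))%:R.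

Lemma pivot_ann a : (a < r)%N -> pivot a \in ann a.+1.
Proof. by move=> ar; apply/annP => //; exists 1; rewrite mulr1. Qed.

Lemma pivot_pow a : (a < r)%N -> pivot a *+ p ^ a = 1 *+ p ^ r.-1.
Proof. by move=> ar; rewrite -mulrnA -expnD; congr (_ *+ (_ ^ _)); lia. Qed.

Lemma pivot_notin_ann a : (a < r)%N -> pivot a \notin ann a.
Proof.
move=> ar; rewrite inE pivot_pow //.
have := annE 1 (leq_pred r); rewrite inE => ->.
by rewrite sub_pred_r expn1 dvdn1 neq_ltn prime_gt1 ?orbT.
Qed.

Definition nf_entry a (j : 'I_m) c (i : 'I_m) : {set 'I_N} :=
  if i == j then [set c] else ann (if (i < j)%N then a else a.+1).

Definition row_box (F : 'I_m -> {set 'I_N}) : {set 'rV['I_N]_m} :=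
  [set x : 'rV_m | [forall i, x 0 i \in F i]].

(** Column j is (p^(r - a - 1), 0), the columns before it are killed by p^a and
    those after it by p^(a + 1). *)
Definition normal_forms a j : {set 'M['I_N]_(2, m)} :=
  [set M : 'M_(2, m) | (row 0 M \in row_box (nf_entry a j (pivot a))) &&
           (row 1 M \in row_box (nf_entry a j 0))].

Lemma normal_formsP a (j : 'I_m) (M : 'M['I_N]_(2, m)) :
  reflect [/\ M 0 j = pivot a, M 1 j = 0,
              forall i : 'I_m, (i < j)%N -> colann M i a &
              forall i : 'I_m, (j < i)%N -> colann M i a.+1]
    (M \in normal_forms a j).
Proof.
rewrite !inE; apply: (iffP andP) => [[/forallP M0 /forallP M1]|[M0j M1j lt_j gt_j]].
  split=> [||i ij|i ij]; rewrite /colann.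
  - by have := M0 j; rewrite mxE /nf_entry eqxx inE => /eqP.
  - by have := M1 j; rewrite mxE /nf_entry eqxx inE => /eqP.
  - have := M0 i; have := M1 i; rewrite !mxE /nf_entry ij -val_eqE /=.
    by rewrite (ltn_eqF ij) => -> ->.
  have := M0 i; have := M1 i; rewrite !mxE /nf_entry ltnNge (ltnW ij) -val_eqE /=.
  by rewrite (gtn_eqF ij) => -> ->.
split; apply/forallP => i; rewrite mxE /nf_entry -val_eqE /=.
  by case: ltngtP => [/lt_j/andP[]|/gt_j/andP[]|/val_inj ->] //; rewrite M0j inE.
by case: ltngtP => [/lt_j/andP[]|/gt_j/andP[]|/val_inj ->] //; rewrite M1j inE.
Qed.

Lemma normal_form_colann a j M i : (a < r)%N -> M \in normal_forms a j -> colann M i a.+1.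
Proof.
move=> ar /normal_formsP[M0 M1 lt_j gt_j].
case: (ltngtP i j) => [/lt_j|/gt_j //|/val_inj ->]; first exact: colann_le.
by rewrite /colann M0 M1 pivot_ann // inE mul0rn eqxx.
Qed.

Lemma normal_form_pivot a j M : (a < r)%N -> M \in normal_forms a j -> ~~ colann M j a.
Proof.
by move=> ar /normal_formsP[M0 M1 _ _]; rewrite /colann M0 (negPf (pivot_notin_ann ar)).
Qed.

(** SL_2 does not change which powers of p kill a given column, and [a] and [j]
    can be read off from these. *)
Lemma normal_form_index a j a' j' g M : (a < r)%N -> (a' < r)%N -> \det g = 1 ->
  M \in normal_forms a j -> g *m M \in normal_forms a' j' -> a = a' /\ j = j'.
Proof.
move=> ar ar' dg MN MN'.
have aa' : a = a'.
  case: (ltngtP a a') => // aa'.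
    have := normal_form_pivot ar' MN'; rewrite colann_sl2 //.
    by rewrite (colann_le aa') // (normal_form_colann _ ar MN).
  have := normal_form_pivot ar MN; rewrite -(colann_sl2 _ _ _ dg).
  by rewrite (colann_le aa') // (normal_form_colann _ ar' MN').
split=> //; rewrite -{}aa' in MN' *; apply/val_inj.
case: (ltngtP (val j) (val j')) => // jj'.
  have := normal_form_pivot ar MN; rewrite -(colann_sl2 _ _ _ dg).
  by have [_ _ -> //] := normal_formsP _ _ _ MN'.
have := normal_form_pivot ar MN'; rewrite colann_sl2 //.
by have [_ _ -> //] := normal_formsP _ _ _ MN.
Qed.

(** With b = a + 1 minimal such that p^b kills [M], and j the first column not
    killed by p^a, column j is p^(r - b) times a vector (u, v); by minimality u or
    v is a unit, so SL_2 takes (u, v) to (1, 0). *)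
Lemma normal_form_meet M : M != 0 -> exists a j g,
  [/\ (a < r)%N, \det g = 1 & g *m M \in normal_forms a j].
Proof.
move=> M0; pose Q b := [forall i, colann M i b].
have exQ : exists b, Q b by exists r; apply/forallP => i; rewrite /colann !ann_r.
have [b /forallP Qb min_b] := ex_minnP exQ.
have b_le : (b <= r)%N by apply: min_b; apply/forallP => i; rewrite /colann !ann_r.
case: b => [|a] in Qb min_b b_le *.
  case/eqP: M0; apply/matrixP => i k; rewrite mxE; have := Qb k.
  by rewrite /colann !ann0 => /andP[/eqP M0 /eqP M1]; case: (ord2E i) => ->.
have {min_b} /forallPn[j0 j0P] : ~~ Q a by apply/negP => /min_b; rewrite ltnn.
have [j jP min_j] := @arg_minnP _ j0 (fun i => ~~ colann M i a) val j0P.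
have /andP[/annP -/(_ b_le)[u Mu] /annP -/(_ b_le)[v Mv]] := Qb j.
suff [g dg [gu gv]] : exists2 g : 'M['I_N]_2, \det g = 1 &
    g 0 0 * u + g 0 1 * v = 1 /\ g 1 0 * u + g 1 1 * v = 0.
  exists a, j, g; split=> //; apply/normal_formsP; split=> [||i ij|i ij].
  - by rewrite mxE sum2E Mu Mv !(mulrCA (g _ _)) -mulrDr gu mulr1.
  - by rewrite mxE sum2E Mu Mv !(mulrCA (g _ _)) -mulrDr gv mulr0.
  - rewrite colann_sl2 //; apply: contraTT ij => /min_j.
    by rewrite -leqNgt.
  by rewrite colann_sl2.
have unit_uv : (u \is a GRing.unit) || (v \is a GRing.unit).
  apply: contraNT jP; rewrite negb_or => /andP[nu nv].
  have := unit_or_ann u; have := unit_or_ann v.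
  rewrite (negPf nu) (negPf nv) /= => vr ur; rewrite /colann Mu Mv.
  have pivot_mul w : w \in ann r.-1 -> pivot a * w \in ann a.
    by rewrite !inE -mulrnAl pivot_pow // mulrnAl mul1r.
  by rewrite !pivot_mul.
pose g w x y z : 'M['I_N]_2 := \matrix_(i, k)
  (if i == 0 then if k == 0 then w else x else if k == 0 then y else z).
have [uu|/negPf nu] := boolP (u \is a GRing.unit).
  exists (g u^-1 0 (- v) u); rewrite ?det2 !mxE /=; first by rewrite mulVr // mulr0 subr0.
  by rewrite mulVr // mul0r addr0; split=> //; ring.
rewrite nu /= in unit_uv; exists (g 0 v^-1 (- v) u); rewrite ?det2 !mxE /=.
  by rewrite mul0r mulNr mulrV // sub0r opprK.
by rewrite mulVr // mul0r add0r; split=> //; ring.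
Qed.

Definition row_shift (M : 'M['I_N]_(2, m)) (y : 'rV['I_N]_m) : 'M['I_N]_(2, m) :=
  \matrix_(i, k) (M i k + if i == 0 then y 0 k else 0).

Lemma row_shift_upper M s : row_shift M (s *: row 1 M) = upper s *m M.
Proof.
apply/matrixP => i k; rewrite !mxE sum2E !mxE.
by case: (ord2E i) => -> /=; rewrite mul1r ?mul0r ?add0r ?addr0.
Qed.

Lemma row_shift_normal_form a j M s : (a < r)%N ->
  M \in normal_forms a j -> upper s *m M \in normal_forms a j.
Proof.
move=> ar /normal_formsP[M0 M1 lt_j gt_j].
have du : \det (upper s) = 1 by rewrite det2 !mxE /=; ring.
apply/normal_formsP; split=> [||i /lt_j|i /gt_j]; rewrite ?colann_sl2 //.
  by rewrite mxE sum2E !mxE /= M0 M1; ring.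
by rewrite mxE sum2E !mxE /= M0 M1; ring.
Qed.

(** Fixing the pivot forces [g] to act as an upper unipotent matrix on everything
    killed by p^(a + 1), because such elements are multiples of the pivot. *)
Lemma normal_form_equiv a j M g : (a < r)%N -> \det g = 1 ->
  M \in normal_forms a j -> g *m M \in normal_forms a j ->
  g *m M = row_shift M (g 0 1 *: row 1 M).
Proof.
move=> ar dg MN /normal_formsP[gM0 gM1 _ _].
have [M0 M1 _ _] := normal_formsP _ _ _ MN.
have g00 : pivot a * g 0 0 = pivot a.
  by move: gM0; rewrite mxE sum2E M0 M1 mulr0 addr0 mulrC.
have g10 : pivot a * g 1 0 = 0.
  by move: gM1; rewrite mxE sum2E M0 M1 mulr0 addr0 mulrC.
have g11 : pivot a * g 1 1 = pivot a.
  have : pivot a * (g 0 0 * g 1 1 - g 1 0 * g 0 1) = pivot a by rewrite -det2 dg mulr1.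
  by rewrite mulrBr !mulrA g00 g10 mul0r subr0.
apply/matrixP => i k; rewrite !mxE sum2E.
have /andP[/annP -/(_ ar)[u Mu] /annP -/(_ ar)[v Mv]] := normal_form_colann k ar MN.
rewrite -/(pivot a) in Mu Mv.
case: (ord2E i) => -> /=; rewrite Mu Mv.
  by rewrite mulrA [g 0 0 * _]mulrC g00.
by rewrite !mulrA [g 1 0 * _]mulrC g10 [g 1 1 * _]mulrC g11; ring.
Qed.

Definition multiples (z : 'rV['I_N]_m) : {set 'rV['I_N]_m} := [set s *: z | s : 'I_N].

(** [None] stands for the zero matrix. *)
Definition normal_forms_of (k : option ('I_r * 'I_m)) : {set 'M['I_N]_(2, m)} :=
  if k is Some (a, j) then normal_forms a j else [set 0].

Lemma normal_forms_of_index k k' M M' : sl2_equiv M M' ->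
  M \in normal_forms_of k -> M' \in normal_forms_of k' -> k = k'.
Proof.
move=> /sl2_equivP[g dg ->] {M'}.
have nz (a : 'I_r) j M0 : M0 \in normal_forms a j -> M0 != 0.
  move=> M0N; apply: contraNneq (normal_form_pivot (ltn_ord a) M0N) => ->.
  by rewrite /colann !mxE !inE mul0rn eqxx.
have ug : g \in unitmx by rewrite unitmxE dg unitr1.
case: k k' => [[a j]|] [[a' j']|] //= MN.
- by move=> /(normal_form_index (ltn_ord a) (ltn_ord a') dg MN)[/val_inj -> ->].
- rewrite inE => /eqP gM0; have /eqP[] := nz _ _ _ MN.
  by rewrite -(mulKmx ug M) gM0 mulmx0.
by move=> /nz; rewrite (set1P MN) mulmx0 eqxx.
Qed.

Lemma card_normal_forms_class k M : M \in normal_forms_of k ->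
  #|[set M' in \bigcup_k' normal_forms_of k' | sl2_equiv M M']| = #|multiples (row 1 M)|.
Proof.
move=> MN; rewrite -(card_imset (multiples _) (f := row_shift M)); last first.
  move=> y y' /matrixP yy'; apply/rowP => i; have := yy' 0 i.
  by rewrite !mxE /=; apply: addrI.
apply: eq_card => M'; rewrite [LHS]inE; apply/andP/imsetP => [[]|[_ /imsetP[s _ ->] ->]].
  move=> /bigcupP[k' _ M'N] MM'; have kk' := normal_forms_of_index MM' MN M'N.
  rewrite -{k'}kk' in M'N; have /sl2_equivP[g dg M'E] := MM'.
  case: k => [[a j]|] /= in MN M'N.
    exists (g 0 1 *: row 1 M); first by apply: imset_f.
    rewrite M'E in M'N *.
    exact: normal_form_equiv (ltn_ord a) dg MN M'N.
  rewrite (set1P M'N) (set1P MN); exists 0; last first.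
    by apply/matrixP => i j; rewrite !mxE if_same addr0.
  by apply/imsetP; exists 0; rewrite ?scale0r.
rewrite row_shift_upper; split; last first.
  by apply/sl2_equivP; exists (upper s) => //; rewrite det2 !mxE /=; ring.
apply/bigcupP; exists k => //; case: k => [[a j]|] /= in MN *.
  exact: row_shift_normal_form.
by rewrite (set1P MN) mulmx0 inE.
Qed.

Lemma card_sl2_classes :
  #|equivalence_partition (@sl2_equiv n m) [set: _]|%:R =
  1 + \sum_(a < r) \sum_j \sum_(M in normal_forms a j) #|multiples (row 1 M)|%:R^-1
  :> rat.
Proof.
rewrite (card_classes_normal_form (NF := \bigcup_k normal_forms_of k)
  (size_in := fun M => #|multiples (row 1 M)|)); first last.
- by move=> M /bigcupP[k _]; apply: card_normal_forms_class.
- move=> M; have [->|M0] := eqVneq M 0.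
    exists 0; first by apply/bigcupP; exists None; rewrite ?inE.
    by apply/sl2_equivP; exists 1%:M; rewrite ?det1 ?mul1mx.
  have [a [j [g [ar dg gN]]]] := normal_form_meet M0.
  exists (g *m M); last by apply/sl2_equivP; exists g.
  by apply/bigcupP; exists (Some (Ordinal ar, j)).
- exact: sl2_equiv_equivalence.
rewrite partition_disjoint_bigcup /=; last first.
  move=> k k'; apply: contraNT => /pred0Pn[M /andP[/= Mk Mk']]; apply/eqP.
  apply: normal_forms_of_index Mk Mk'.
  by apply/sl2_equivP; exists 1%:M; rewrite ?det1 ?mul1mx.
rewrite (bigD1 None) //= big_set1; congr (_ + _).
  rewrite (eq_card1 (x := 0)) ?invr1 // => y; rewrite inE.
  have -> : row 1 (0 : 'M['I_N]_(2, m)) = 0 by apply/rowP => i; rewrite !mxE.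
  apply/imsetP/eqP => [[s _ ->]|->]; first by rewrite scaler0.
  by exists 0; rewrite ?scaler0.
rewrite pair_big (reindex_omap Some id) => [|[]] //=.
by apply: eq_big => [k|[a j] _ //]; rewrite eqxx.
Qed.

Lemma card_row_box F : #|row_box F| = (\prod_i #|F i|)%N.
Proof.
under eq_bigr do rewrite -sum1_card big_mkcond.
rewrite bigA_distr_bigA /= -sum1_card big_mkcond /=.
rewrite (reindex (fun f : {ffun 'I_m -> 'I_N} => \row_i f i)) /=; last first.
  exists (fun x : 'rV_m => [ffun i => x 0 i]) => x _.
    by apply/ffunP => i; rewrite ffunE mxE.
  by apply/rowP => i; rewrite mxE ffunE.
apply: eq_bigr => f _; rewrite inE; case: ifPn => [/forallP fF|/forallPn[i fi]].
  by rewrite big1 // => i _; have := fF i; rewrite mxE => ->.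
by move: fi; rewrite mxE => /negPf fi; rewrite (bigD1 i) //= fi.
Qed.

Lemma sum_ltn_ord k j : (\sum_(i < k) (j < i) = k.-1 - j)%N.
Proof.
elim: k => [|k IHk]; first by rewrite big_ord0.
by rewrite big_ord_recr /= IHk; lia.
Qed.

Lemma card_nf_row a j c : (a < r)%N ->
  #|row_box (nf_entry a j c)| = (p ^ (a * m.-1 + (m.-1 - j)))%N.
Proof.
move=> ar; rewrite card_row_box.
have entryE i : #|nf_entry a j c i| = (p ^ (if i == j then 0 else a + (j < i)))%N.
  rewrite /nf_entry -val_eqE /=; case: ltngtP => ij; rewrite ?cards1 //.
  - by rewrite card_ann ?addn0 // ltnW.
  - by rewrite card_ann // addn1.
under eq_bigr do rewrite entryE.
rewrite -expn_sum; congr (_ ^ _)%N.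
rewrite (bigD1 j) //= eqxx add0n (eq_bigr (fun i : 'I_m => a + (j < i)))%N; last first.
  by move=> i /negPf ->.
rewrite big_split /= sum_nat_const cardC1 card_ord mulnC; congr (_ + _)%N.
have -> : (\sum_(i < m | i != j) (j < i) = \sum_(i < m) (j < i))%N.
  by rewrite [RHS](bigD1 j) //= ltnn.
exact: sum_ltn_ord.
Qed.

Lemma card_nf_row_ann a j b : (a < r)%N -> (b <= a)%N ->
  #|[set z in row_box (nf_entry a j 0) | z *+ p ^ b == 0]| = (p ^ (b * m.-1))%N.
Proof.
move=> ar ba; transitivity #|row_box (fun i => if i == j then [set 0] else ann b)|.
  apply: eq_card => z; rewrite !inE; apply/andP/forallP => [[/forallP zF /eqP z0] i|zF].
    have := zF i; rewrite /nf_entry; case: ifP => // _ _.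
    by rewrite inE -mulmxnE z0 mxE.
  split; last first.
    apply/eqP/rowP => i; rewrite mulmxnE mxE; have := zF i.
    by case: ifP => _; rewrite inE => /eqP -> //; rewrite mul0rn.
  apply/forallP => i; have := zF i; rewrite /nf_entry; case: ifP => // _.
  by apply: ann_le; case: ifP => // _; apply: leqW.
rewrite card_row_box (bigD1 j) //= eqxx cards1 mul1n.
rewrite (eq_bigr (fun=> p ^ b))%N => [|i /negPf ->]; last first.
  by rewrite card_ann // ltnW // (leq_ltn_trans ba).
by rewrite prod_nat_const cardC1 card_ord -expnM.
Qed.

Lemma sum_normal_forms a j :
  \sum_(M in normal_forms a j) #|multiples (row 1 M)|%:R^-1 =
  #|row_box (nf_entry a j (pivot a))|%:R *
    \sum_(z in row_box (nf_entry a j 0)) #|multiples z|%:R^-1 :> rat.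
Proof.
pose stack (xz : 'rV['I_N]_m * 'rV['I_N]_m) : 'M['I_N]_(2, m) :=
  \matrix_(i, k) (if i == 0 then xz.1 0 k else xz.2 0 k).
have stack0 xz : row 0 (stack xz) = xz.1 by apply/rowP => i; rewrite !mxE.
have stack1 xz : row 1 (stack xz) = xz.2 by apply/rowP => i; rewrite !mxE.
rewrite (reindex stack) /=; last first.
  exists (fun M => (row 0 M, row 1 M)) => [[x z]|M] _.
    by rewrite stack0 stack1.
  by apply/matrixP => i k; case: (ord2E i) => ->; rewrite !mxE.
rewrite -sumr_const mulr_suml.
under [RHS]eq_bigr do rewrite mul1r.
rewrite pair_big /=; apply: eq_big => [xz|xz _]; last by rewrite stack1.
by rewrite inE stack0 stack1.
Qed.

(** If [z] has order p^c, the difference of the two indicators is 1 exactly for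
    k + 1 = c, and the leading term is 1 exactly for c = 0. *)
Lemma inv_card_multiples b z : z *+ p ^ b = 0 ->
  #|multiples z|%:R^-1 = (z *+ p ^ 0 == 0)%:R +
    \sum_(k < b) ((z *+ p ^ k.+1 == 0)%:R - (z *+ p ^ k == 0)%:R) / p%:R ^+ k.+1
  :> rat.
Proof.
move=> z0; have [c -> cE] := card_multiples z0; under eq_bigr do rewrite !cE.
have cb : (c <= b)%N by rewrite -cE z0.
rewrite cE leqn0; case: c cE cb => [|c] cE cb.
  by rewrite big1 ?addr0 ?invr1 // => k _; rewrite subrr mul0r.
rewrite add0r (bigD1 (Ordinal cb)) //= leqnn ltnn subr0 mul1r natrX big1 ?addr0 //.
move=> k kc; rewrite ltnS leq_eqVlt [(c == k)%N]eq_sym -[(val k == c)]/(k == Ordinal cb).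
by rewrite (negPf kc) subrr mul0r.
Qed.

Lemma sum_inv_card_multiples a (j : 'I_m) : (a < r)%N -> 
  \sum_(z in row_box (nf_entry a j 0)) #|multiples z|%:R^-1 =
  1 + \sum_(b < a.+1)
    (torsion_count p m a j b.+1 - torsion_count p m a j b) / p%:R ^+ b.+1.
Proof.
move=> ar; set q := torsion_count p m a j; set Z := row_box _.
have zZ z : z \in Z -> z *+ p ^ a.+1 = 0.
  rewrite inE => /forallP zF; apply/rowP => i; rewrite mulmxnE mxE.
  have := zF i; rewrite /nf_entry; case: ifP => _.
    by rewrite inE => /eqP ->; rewrite mul0rn.
  move=> zi; suff : z 0 i \in ann a.+1 by rewrite inE => /eqP.
  by apply: ann_le zi; case: ifP.
have qE b : (b <= a.+1)%N -> \sum_(z in Z) (z *+ p ^ b == 0)%:R = q b.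
  move=> ba; transitivity (#|[set z in Z | z *+ p ^ b == 0]|%:R : rat).
    rewrite -sumr_const big_mkcond [RHS]big_mkcond; apply: eq_bigr => z _.
    by rewrite !inE; case: ifP => //= _; case: eqP.
  rewrite /q /torsion_count; case: ifP => [ba'|/negbT]; first by rewrite card_nf_row_ann.
  rewrite -ltnNge => ab; have -> : b = a.+1 by apply/eqP; rewrite eqn_leq ba.
  rewrite /row_count -(card_nf_row _ 0 ar); congr (_%:R); apply: eq_card => z; rewrite inE.
  by case: (boolP (z \in Z)) => [/zZ ->|] //; rewrite eqxx.
rewrite (eq_bigr _ (fun z zP => inv_card_multiples (zZ z zP))) big_split /=.
rewrite qE // {1}/q /torsion_count leq0n mul0n expn0; congr (_ + _).
rewrite exchange_big; apply: eq_bigr => b _ /=.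
by rewrite -mulr_suml sumrB !qE // ltnW.
Qed.

End OrbitCount.

(** * Summation over the normal forms *)
Section FinalSum.
Variable p : nat.
Hypothesis p_pr : prime p.
Local Notation P := (p%:R : rat).

Let P_neq0 : P != 0.
Proof. by rewrite pnatr_eq0 -lt0n prime_gt0. Qed.

Let PX_neq1 k : (0 < k)%N -> P ^+ k - 1 != 0.
Proof.
move=> k0; rewrite subr_eq0 -natrX pnatr_eq1 -(expn0 p) eqn_exp2l ?prime_gt1 //.
by rewrite -lt0n.
Qed.

Lemma gauss_binom1 m : gauss_binom p m 1 = (P ^+ m - 1) / (P - 1).
Proof. by rewrite /gauss_binom big_nat1 subn0. Qed.

Lemma gauss_binom2 m :
  gauss_binom p m 2 = (P ^+ m - 1) / (P ^+ 2 - 1) * ((P ^+ (m - 1) - 1) / (P - 1)).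
Proof. by rewrite /gauss_binom big_nat_recl // big_nat1 subn0. Qed.

Lemma sum_rev_pow (x : rat) m : \sum_(j < m) x ^+ (m.-1 - j) = \sum_(j < m) x ^+ j.
Proof.
rewrite (reindex_inj rev_ord_inj) /=; apply: eq_bigr => j _.
by congr (_ ^+ _); have := ltn_ord j; lia.
Qed.

Lemma geometric_sum (x : rat) m : x - 1 != 0 -> \sum_(j < m) x ^+ j = (x ^+ m - 1) / (x - 1).
Proof. by move=> x1; rewrite [x ^+ m - 1]subrX1 mulrC mulKf. Qed.

Lemma row_countE m a j : row_count p m a j = P ^+ (a * m.-1) * P ^+ (m.-1 - j).
Proof. by rewrite /row_count natrX exprD. Qed.

Lemma sum_row_count m a : \sum_(j < m) row_count p m a j = Ncyc p m a.+1.
Proof.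
under eq_bigr do rewrite row_countE.
rewrite -mulr_sumr sum_rev_pow geometric_sum ?(PX_neq1 (k := 1)) //.
by rewrite /Ncyc gauss_binom1 !subn1.
Qed.

Lemma Npair_lt d b e : Npair p d.+2 (b + e.+1).+1 b.+1 =
  P ^+ (b * d + b * d + d + e * d.+1) * ((P ^+ d.+1 - 1) / (P - 1)) *
    ((P ^+ d.+2 - 1) / (P - 1)).
Proof.
rewrite /Npair gtn_eqF; last by lia.
rewrite !gauss_binom1.
have -> : (2 * b.+1 - 1 = b + b + 1)%N by lia.
have -> : ((b + e.+1).+1 - b.+1 - 1 = e)%N by lia.
by rewrite !subSS !subn0; congr (_ ^+ _ * _ * _); ring.
Qed.

Lemma Npair_diag d a : Npair p d.+2 a.+1 a.+1 =
  P ^+ (a * d + a * d) *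
    ((P ^+ d.+2 - 1) / (P ^+ 2 - 1) * ((P ^+ d.+1 - 1) / (P - 1))).
Proof.
rewrite /Npair eqxx gauss_binom2 !subSS !subn0; congr (_ ^+ _ * _).
ring.
Qed.

Lemma totient_prime_power b : (totient (p ^ b.+1))%:R = (P - 1) * P ^+ b.
Proof. by rewrite totient_pfactor // natrM natrX -subn1 natrB ?prime_gt0. Qed.

(** Vectors of order p^(b + 1) with b < a: their number is the same for all j, so
    only the first rows have to be summed over j. *)
Lemma sum_torsion_lt d a b : (b < a)%N ->
  \sum_(j < d.+2) row_count p d.+2 a j *
    ((torsion_count p d.+2 a j b.+1 - torsion_count p d.+2 a j b) / P ^+ b.+1) =
  (totient (p ^ b.+1))%:R * Npair p d.+2 a.+1 b.+1.
Proof.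
move=> ba; under eq_bigr do rewrite /torsion_count ba ltnW //.
have [e ->] : exists e, a = (b + e.+1)%N by exists (a - b.+1)%N; lia.
rewrite -mulr_suml sum_row_count /Ncyc gauss_binom1 totient_prime_power Npair_lt.
have P1 := PX_neq1 (ltn0Sn 0); rewrite !subn1 !natrX.
have -> : P ^+ ((b + e.+1).+1.-1 * d.+2.-1) =
  P ^+ (b * d) * P ^+ (e * d.+1) * P ^+ b * P ^+ d * P.
  by rewrite -!exprD -exprSr; congr (_ ^+ _); lia.
have -> : P ^+ (b.+1 * d.+2.-1) = P ^+ (b * d) * P ^+ b * P ^+ d * P.
  by rewrite -!exprD -exprSr; congr (_ ^+ _); lia.
have -> : P ^+ (b * d.+2.-1) = P ^+ (b * d) * P ^+ b.
  by rewrite -!exprD; congr (_ ^+ _); lia.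
rewrite !exprD !exprS; set Pb := P ^+ b; set Pd := P ^+ d.
have Pb0 : Pb != 0 by rewrite expf_neq0.
by rewrite expr1 in P1; field; rewrite Pb0 P_neq0 P1.
Qed.

(** Vectors of the maximal order p^(a + 1): their number depends on j, and the
    geometric sums of P^(2 i) and P^i combine to the Gaussian binomial of m
    over 2. *)
Lemma sum_torsion_eq d a :
  \sum_(j < d.+2) row_count p d.+2 a j *
    ((torsion_count p d.+2 a j a.+1 - torsion_count p d.+2 a j a) / P ^+ a.+1) =
  (totient (p ^ a.+1))%:R * Npair p d.+2 a.+1 a.+1.
Proof.
rewrite /torsion_count ltnn leqnn totient_prime_power Npair_diag.
under eq_bigr => j _.
  rewrite row_countE natrX.
  have -> : P ^+ (a * d.+2.-1) * P ^+ (d.+2.-1 - j) *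
      ((P ^+ (a * d.+2.-1) * P ^+ (d.+2.-1 - j) - P ^+ (a * d.+2.-1)) / P ^+ a.+1) =
      P ^+ (a * d.+2.-1) ^+ 2 / P ^+ a.+1 *
        ((P ^+ 2) ^+ (d.+2.-1 - j) - P ^+ (d.+2.-1 - j)).
    by rewrite [(P ^+ 2) ^+ _]exprAC; ring.
  over.
rewrite -mulr_sumr sumrB !sum_rev_pow.
have P1 := PX_neq1 (ltn0Sn 0); have P2 := PX_neq1 (ltn0Sn 1).
rewrite !geometric_sum // [_ ^+ 2 ^+ _]exprAC.
have -> : P ^+ (a * d.+2.-1) = P ^+ (a * d) * P ^+ a.
  by rewrite -!exprD; congr (_ ^+ _); lia.
rewrite exprD !exprS; set Pa := P ^+ a; set Pd := P ^+ d.
have Pa0 : Pa != 0 by rewrite expf_neq0.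
rewrite expr1 in P1; rewrite expr0 mulr1.
by field; rewrite P1 -expr2 P2 Pa0 P_neq0.
Qed.

Lemma sum_torsion_m1 a b (j : 'I_1) :
  torsion_count p 1 a j b.+1 - torsion_count p 1 a j b = 0.
Proof. by rewrite /torsion_count /row_count ord1 !muln0 !if_same subrr. Qed.

End FinalSum.

Theorem theorem5p5 (R : realType) (p t m r : nat) :
  prime p -> (2 <= t)%N -> m = (t - 1)%N -> (1 <= r)%N ->
  (commutant_dim R t (p ^ r)%N)%:R =
    1 + \sum_(1 <= a < r.+1) Ncyc p m a
      + (if m == 1%N then 0
         else \sum_(1 <= a < r.+1) \sum_(1 <= b < a.+1)
                (totient (p ^ b)%N)%:R * Npair p m a b) :> rat.
Proof.
move=> p_pr t2 m_def r1.
have tE : t = m.+1 by lia.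
have m_gt0 : (0 < m)%N by lia.
have pr_gt1 : (1 < p ^ r)%N by rewrite -(expn0 p) ltn_exp2l ?prime_gt1.
have [n Npr] : exists n, n.+2 = (p ^ r)%N by exists (p ^ r).-2; lia.
have [zeta zetaP] := @primitive_root_exists R[i] (2 * n.+2) isT.
rewrite /commutant_dim -Npr tE /=.
rewrite (commutant_dim_orbits m zetaP (local_Zpr p_pr Npr)).
rewrite (card_sl2_classes m p_pr Npr) -addrA; congr (1 + _).
have sum_nf (a : 'I_r) :
    \sum_(j < m) \sum_(M in @normal_forms p r n m a j) #|multiples (row 1 M)|%:R^-1 =
    Ncyc p m a.+1 + (if m == 1%N then 0 else
      \sum_(b < a.+1) (totient (p ^ b.+1))%:R * Npair p m a.+1 b.+1) :> rat.
  transitivity (\sum_(j < m) row_count p m a j * (1 + \sum_(b < a.+1)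
      (torsion_count p m a j b.+1 - torsion_count p m a j b) / p%:R ^+ b.+1)).
    apply: eq_bigr => j _; rewrite sum_normal_forms.
    by rewrite (card_nf_row p_pr Npr) // (sum_inv_card_multiples p_pr Npr).
  under eq_bigr do rewrite mulrDr mulr1 mulr_sumr.
  rewrite big_split /= sum_row_count // exchange_big /=; congr (_ + _).
  case: eqP => [m1|/eqP m1].
    subst m; rewrite m1; apply: big1 => b _; apply: big1 => j _.
    by rewrite sum_torsion_m1 ?mul0r ?mulr0.
  have [d ->] : exists d, m = d.+2 by exists (m - 2)%N; lia.
  apply: eq_bigr => b _; have := ltn_ord b; rewrite ltnS leq_eqVlt.
  by case/orP=> [/eqP ->|ba]; [apply: sum_torsion_eq | apply: sum_torsion_lt].
rewrite (eq_bigr _ (fun a _ => sum_nf a)) big_split /=.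
rewrite [in RHS]big_add1 big_mkord; congr (_ + _).
case: eqP => _; first exact: big1.
rewrite [RHS]big_add1 big_mkord; apply: eq_bigr => a _.
by rewrite [RHS]big_add1 big_mkord.
Qed.
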